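(* For each $\varepsilon>0$ and $\Delta\in\mathbb{N}$ there exists $\alpha=\alpha(\varepsilon,\Delta)>0$ such that the following holds for all sufficiently large $n\in\mathbb{N}$. Every $n$-vertex graph $G$ with $\delta(G)\ge\varepsilon n$ and $\alpha^*(G)<\alpha n$ is $\mathcal{T}(n,\Delta)$-universal, that is, $G$ contains every $T\in\mathcal{T}(n,\Delta)$ as a subgraph.
   Context: Graphs are finite and simple; $\delta(G)$ is the minimum degree of $G$. For nonnegative integers $s,t$, an $(s,t)$-bipartite-hole in a graph $G$ consists of two disjoint sets $S,T\subseteq V(G)$ with $|S|=s$ and $|T|=t$ such that there is no edge of $G$ joining $S$ and $T$. The bipartite independence number $\alpha^*(G)$ is the maximum integer $t$ such that $G$ contains a $(t,t)$-bipartite-hole. $\mathcal{T}(n,\Delta)$ denotes the family of all trees on $n$ vertices with maximum degree at most $\Delta$. Containment as a subgraph means there is an injective map $V(T)\to V(G)$ sending edges of $T$ to edges of $G$ (not necessarily induced). *)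

(* Defs.v *)
(* Libraries: MathComp, with the reals of MathComp-Analysis (realType). *)
From HB Require Import structures.
From mathcomp Require Import all_boot all_order all_algebra.
From mathcomp Require Import reals.

Set Implicit Arguments.
Unset Strict Implicit.
Unset Printing Implicit Defensive.

Record sgraph := SGraph {
  vertex :> finType;
  edge : rel vertex;
  edge_sym : symmetric edge;
  edge_irrefl : irreflexive edge }.

Definition degree (G : sgraph) (x : G) : nat := #|[set y | edge x y]|.

(* The index #|G| of the iterated minimum exceeds every degree, so it is only
   attained when G has no vertex. *)
Definition min_degree (G : sgraph) : nat :=
  \big[minn/#|G|]_(x : G) degree x.

Definition max_degree (G : sgraph) : nat := \max_(x : G) degree x.

Definition bipartite_hole (G : sgraph) (s t : nat) (S T : {set G}) : bool :=
  [&& [disjoint S & T], #|S| == s, #|T| == t &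
      [forall x in S, forall y in T, ~~ edge x y]].

Definition has_bipartite_hole (G : sgraph) (s t : nat) : bool :=
  [exists S : {set G}, exists T : {set G}, bipartite_hole s t S T].

(* A (t, t)-hole has t <= #|G|, so bounding t loses nothing; t = 0 always
   qualifies, with two empty sets. *)
Definition bip_indep_number (G : sgraph) : nat :=
  \max_(t < #|G|.+1 | has_bipartite_hole G t t) t.

Definition connected_graph (G : sgraph) : Prop :=
  (0 < #|G|)%N /\ forall x y : G, connect (@edge G) x y.

(* For ucycle, [:: x; y] is a cycle whenever xy is an edge; graph cycles are
   the duplicate-free ones of length at least 3. *)
Definition acyclic_graph (G : sgraph) : Prop :=
  forall c : seq G, (3 <= size c)%N -> ~ ucycle (@edge G) c.

Definition is_tree (G : sgraph) : Prop :=
  connected_graph G /\ acyclic_graph G.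

Definition tree_family (n Delta : nat) (T : sgraph) : Prop :=
  [/\ is_tree T, #|T| = n & (max_degree T <= Delta)%N].

Definition contains_subgraph (G H : sgraph) : Prop :=
  exists f : H -> G,
    injective f /\ forall x y : H, edge x y -> edge (f x) (f y).

Definition universal (G : sgraph) (F : sgraph -> Prop) : Prop :=
  forall H : sgraph, F H -> contains_subgraph G H.

(* Main.v *)
Require Import Defs.
From mathcomp Require Import all_boot all_order all_algebra.
From mathcomp Require Import zify reals.
Import Order.TTheory GRing.Theory Num.Theory.

(** Write [n] for the common order of the host [G] and of the tree [T], [D] for
    the bound on the degrees of [T], and [m] for one more than the bipartite
    independence number, so that any two disjoint [m]-sets of [G] are joined by
    an edge ([joined]).  Every vertex of [G] has degree at least [n / K], while
    [m] is a tiny fraction of [n].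

    Embedding all but a small part of [T] is easy, because a partial embedding
    can be grown leaf by leaf as in the theorem of Friedman and Pippenger
    ([extendable_step]).  The difficulty is to use the last vertices of [G],
    about which nothing is known.  They are absorbed as follows.

    A tree vertex [w] whose tree-neighbours are all mapped into the
    neighbourhood of a vertex [x] can be moved to [x]; its former image [f w]
    becomes free.  Such a [w] is a slot of [x] ([slots]).  A subtree of size
    proportional to [m + log n] is embedded so that every vertex [x] of [G] has
    many slots ([absorbers_exist]).  This is possible because averaging over
    the stars of [G] always yields a star whose leaves lie in the neighbourhood
    of a constant fraction of the vertices, for any weighting of these vertices
    ([pick_star]); weights that halve whenever a vertex gains a slot spread the
    slots evenly.

    A leftover [x] thus gives access to a large set of free vertices, but its
    slots may all lie far from the place that has to be filled.  So the places
    are prepared too ([gap_step]).  A gap is a closed neighbourhood in [T] of a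
    centre [c]; it stays unembedded.  For each neighbour [q] of [c] one vertex
    [v q] of [G] is reserved, and the images of the other neighbours of [q], the
    anchors, are chosen so that many slots of [v q] have an image adjacent to
    all of them ([anchored_slots]).  In the end every gap has one leftover
    vertex for its centre, plus the reserved vertices.  The centre receives the
    image of a slot of the leftover vertex, each [q] the image of an anchored
    slot of [v q]; these sets have size at least a multiple of [m], so
    joinedness provides the edges between the centre and its neighbours
    ([fill_cell]).  No relation between the leftover vertex and its gap is
    required, hence all the leftover vertices can be used up ([fill]).

    The number of gaps is [2 * m * (D + 1)], which is what the leaf-by-leaf
    extension needs as free space when it places the last tree vertex outside
    the gaps ([complete]).  All the sizes are bounded by a constant times
    [m + log n], and this fits into [n] ([contains_tree]). *)

Set Implicit Arguments.
Unset Strict Implicit.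
Unset Printing Implicit Defensive.

Local Open Scope nat_scope.

(** * Neighbourhoods, averaging and joined graphs *)

Definition nbr (G : sgraph) (x : G) : {set G} := [set y | edge x y].

Definition joined (G : sgraph) (m : nat) : Prop :=
  forall S S' : {set G}, m <= #|S| -> m <= #|S'| -> [disjoint S & S'] ->
    exists x y, [/\ x \in S, y \in S' & edge x y].

Lemma in_nbr (G : sgraph) (x y : G) : (y \in nbr x) = edge x y.
Proof. by rewrite inE. Qed.

Lemma subset_of_card (I : finType) (S : {set I}) k :
  k <= #|S| -> exists2 S' : {set I}, S' \subset S & #|S'| = k.
Proof.
move=> lekS; exists [set x in take k (enum S)].
  by apply/subsetP=> x; rewrite inE => /mem_take; rewrite mem_enum.
rewrite cardsE (card_uniqP _) ?take_uniq ?enum_uniq //.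
by rewrite size_takel // -cardE.
Qed.

Lemma leq_card_bigcup (I J : finType) (A : {set I}) (F : I -> {set J}) k :
  {in A, forall i, #|F i| <= k} -> #|\bigcup_(i in A) F i| <= #|A| * k.
Proof.
move=> Fk; rewrite -sum_nat_const.
apply: (@leq_trans (\sum_(i in A) #|F i|)); last exact: leq_sum.
elim/big_rec2: _ => [|i s U _ h]; first by rewrite cards0.
by apply: leq_trans (leq_card_setU _ _) _; rewrite leq_add2l.
Qed.

Lemma disjoint_setDr (I : finType) (S S' : {set I}) : [disjoint S & S' :\: S].
Proof. by rewrite disjoint_sym disjoints_subset setDE subsetIr. Qed.

Lemma greedy_sdr (I : eqType) (J : finType) (j0 : J) (l : seq I) (N : I -> {set J}) :
    uniq l -> {in l, forall i, size l <= #|N i|} ->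
  exists2 s : I -> J, {in l &, injective s} & {in l, forall i, s i \in N i}.
Proof.
elim: l N => [|i l IH] /= N; first by exists (fun _ => j0).
case/andP=> il ul sN.
have /card_gt0P[j ji] : 0 < #|N i|.
  by apply: leq_trans (sN i _); rewrite ?inE ?eqxx.
have [|s si sS] := IH (fun k => N k :\ j) ul.
  move=> k kl; have := sN k; rewrite inE kl orbT => /(_ isT).
  by rewrite (cardsD1 j); case: (_ \in _) => /=; lia.
have nil k : k \in l -> (k == i) = false.
  by move=> kl; apply/negbTE; apply: contraNneq il => <-.
exists (fun k => if k == i then j else s k).
  move=> x y; rewrite !inE; case: (eqVneq x i) => [->|nx]; case: (eqVneq y i) => [->|ny] //= xl yl.
  - by move=> e; have := sS y yl; rewrite -e !inE eqxx.
  - by move=> e; have := sS x xl; rewrite e !inE eqxx.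
  - exact: si.
by move=> k; rewrite inE; case: eqVneq => [-> //|_ /= /sS]; rewrite inE => /andP[].
Qed.

Section Averaging.

Variables (I J : finType) (R : I -> J -> bool).

(** Double counting of the related pairs, weighted by [w]: on average over [C]
    the related elements have at least [b / #|C|] of the total weight. *)
Lemma averaging (w : I -> nat) (Z : {set I}) (C : {set J}) (b B : nat) :
    0 < #|C| -> #|C| <= B * b ->
    {in Z, forall z, b <= #|[set c in C | R z c]|} ->
  exists2 c, c \in C &
    \sum_(z in Z) w z <= B * \sum_(z in Z | R z c) w z.
Proof.
move=> C0 CB Zb.
case: (boolP [exists c in C, \sum_(z in Z) w z <= B * \sum_(z in Z | R z c) w z]).
  by move/exists_inP => [c cC h]; exists c.
move/exists_inPn => h; exfalso.
have lt_c c : c \in C -> B * (\sum_(z in Z | R z c) w z) < \sum_(z in Z) w z.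
  by move=> /h; rewrite -ltnNge.
have : \sum_(c in C) (B * (\sum_(z in Z | R z c) w z)).+1
       <= \sum_(c in C) (\sum_(z in Z) w z) by apply: leq_sum.
rewrite sum_nat_const.
under eq_bigr => c _ do rewrite -addn1.
rewrite big_split /= sum1_card -big_distrr /=.
have -> : \sum_(c in C) \sum_(z in Z | R z c) w z
   = \sum_(z in Z) \sum_(c in C | R z c) w z.
  rewrite (exchange_big_dep (mem Z)) /=; last by move=> c z _ /andP[].
  by apply: eq_bigr => z zZ; apply: eq_bigl => c; rewrite zZ.
have : b * (\sum_(z in Z) w z) <= \sum_(z in Z) \sum_(c in C | R z c) w z.
  rewrite big_distrr /=; apply: leq_sum => z zZ.
  rewrite sum_nat_cond_const.
  by rewrite leq_mul2r (Zb z zZ) orbT.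
move=> h1 h2.
have := leq_mul (leqnn B) h1; have := leq_mul CB (leqnn (\sum_(z in Z) w z)).
nia.
Qed.

End Averaging.

Lemma free_nbrs (G : sgraph) (h u : nat) (X : {set G}) (x : G) :
  (forall z : G, h + u <= #|nbr z|) -> #|X| <= u -> h <= #|nbr x :\: X|.
Proof.
move=> /(_ x) dx cX; have := cardsID X (nbr x).
have := subset_leq_card (subsetIr (nbr x) X); lia.
Qed.

Section Graph.

Variable G : sgraph.

(** One image after the other is chosen by [averaging] among the common
    candidates [C], each time keeping only the part of [Z] adjacent to the
    chosen image; [b + size l] leaves room for the images already taken.  This
    is used both for the leaves of an absorbing star, with [Z] weighted, and for
    anchors, with [Z] the images of the slots of a reserved vertex. *)
Lemma pick_common (V : eqType) (l : seq V) (w : G -> nat) (Z C : {set G})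
    (b B : nat) :
    uniq l -> 0 < b -> b + size l <= #|C| -> #|C| <= B * b ->
    {in Z, forall z, b + size l <= #|nbr z :&: C|} ->
  exists g : V -> G, [/\ {in l &, injective g}, {in l, forall x, g x \in C} &
    \sum_(z in Z) w z <=
      B ^ size l * \sum_(z in Z | all (fun x => edge z (g x)) l) w z].
Proof.
move=> ul b0; elim: l ul Z C => [|x l IH] /= ul Z C bC CB Zb.
  have /card_gt0P[c _] : 0 < #|C| by lia.
  exists (fun _ => c); split => //.
  by rewrite expn0 mul1n; apply: eq_leq; apply: eq_bigl => z; rewrite andbT.
case/andP: ul => xl ul.
have [|||c cC hc] := @averaging _ _ (@edge G) w Z C b B.
- by lia.
- by [].
- move=> z /Zb h; apply: (@leq_trans #|nbr z :&: C|); first by lia.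
  by apply: subset_leq_card; apply/subsetP=> y; rewrite !inE andbC.
have [||z|g [gi gC gs]] := IH ul [set z in Z | edge z c] (C :\ c).
- by rewrite (cardsD1 c) cC in bC; lia.
- by apply: leq_trans CB; apply: subset_leq_card; apply: subsetDl.
- rewrite inE => /andP[/Zb h _].
  rewrite setIDA; have := cardsD1 c (nbr z :&: C).
  by case: (c \in _) => /=; lia.
exists (fun y => if y == x then c else g y); split.
- move=> y y'; rewrite !inE.
  case: (eqVneq y x) => [->|ny]; case: (eqVneq y' x) => [->|ny'] //= yl yl'.
  + by move=> e; have := gC _ yl'; rewrite -e !inE eqxx.
  + by move=> e; have := gC _ yl; rewrite e !inE eqxx.
  + exact: gi.
- move=> y; rewrite inE; case: eqVneq => //= _ /gC.
  by rewrite !inE => /andP[].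
- rewrite eqxx; apply: leq_trans hc _; rewrite expnS -mulnA leq_mul2l.
  apply/orP; right.
  have -> : \sum_(z in Z | edge z c) w z = \sum_(z in [set z in Z | edge z c]) w z.
    by apply: eq_bigl => z; rewrite inE.
  apply: leq_trans gs _; rewrite leq_mul2l; apply/orP; right.
  apply: eq_leq; apply: eq_bigl => z; rewrite inE -andbA; congr (_ && (_ && _)).
  apply: eq_in_all => y yl; case: eqVneq => // e.
  by rewrite -e yl in xl.
Qed.

Variable m : nat.
Hypothesis Gm : joined G m.

Lemma joined_overlap (S S' : {set G}) :
  m <= #|S| -> 2 * m <= #|S'| -> exists x y, [/\ x \in S, y \in S' & edge x y].
Proof.
move=> /subset_of_card[S1 sS1 c1] c2.
have [|||x [y [xS yS e]]] := Gm (S := S1) (S' := S' :\: S1).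
- by rewrite c1.
- by have := cardsID S1 S'; have := subset_leq_card (subsetIr S' S1); lia.
- exact: disjoint_setDr.
exists x, y; split => //; first exact: (subsetP sS1).
by move: yS; rewrite inE => /andP[].
Qed.

(** Together, [m] vertices with at most [k] neighbours each in [S] miss at least
    [m] vertices of [S], which would be a bipartite hole. *)
Lemma few_poor (Y S : {set G}) k :
  0 < m ->
  m * (k + 2) <= #|S| -> #|[set x in Y | #|nbr x :&: S| <= k]| < m.
Proof.
move=> m0 cS; rewrite ltnNge; apply/negP => /subset_of_card[B sB cB].
have hN : #|\bigcup_(x in B) (nbr x :&: S)| <= m * k.
  rewrite -cB; apply: leq_card_bigcup => x /(subsetP sB).
  by rewrite inE => /andP[].
set A := \bigcup_(x in B) _ in hN.
have [||| x [y [xB yS e]]] := Gm (S := B) (S' := S :\: A :\: B).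
- by rewrite cB.
- have := cardsID B (S :\: A); have := subset_leq_card (subsetIr (S :\: A) B).
  have := cardsID A S; have := subset_leq_card (subsetIr S A).
  rewrite cB; lia.
- exact: disjoint_setDr.
move: yS; rewrite !inE => /and3P[_ /negP nA yS]; apply: nA.
by apply/bigcupP; exists x; rewrite // !inE e.
Qed.

End Graph.

(** * Extension of a partial embedding by one leaf *)

Section FriedmanPippenger.

Variables (G : sgraph) (m D : nat).
Hypothesis Gm : joined G m.
Hypothesis m0 : 0 < m.
Implicit Types (U X : {set G}) (dem : G -> nat).

Definition nbrs U : {set G} := \bigcup_(x in U) nbr x.

(** The condition of Friedman and Pippenger: [X] is the set of occupied vertices
    and [dem x] bounds the number of children still to be attached at [x].  Large sets
    satisfy it automatically in a joined graph, which is why only sets of at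
    most [2 * m] vertices are considered. *)
Definition extendable X dem :=
  forall U, #|U| <= 2 * m -> \sum_(x in U) dem x <= #|nbrs U :\: X|.

Lemma nbrsU U1 U2 : nbrs (U1 :|: U2) = nbrs U1 :|: nbrs U2.
Proof. exact: bigcup_setU. Qed.

Lemma nbrs_large X U : m <= #|U| -> #|~: X| < #|nbrs U :\: X| + 2 * m.
Proof.
move=> /subset_of_card[U' sU' cU']; rewrite ltnNge; apply/negP => h.
have [|||x [y [xU yS e]]] := Gm (S := U') (S' := ~: nbrs U :\: X :\: U').
- by rewrite cU'.
- have h1 : ~: X = (nbrs U :\: X) :|: (~: nbrs U :\: X).
    by apply/setP => x; rewrite !inE; case: (x \in X); case: (x \in nbrs U).
  have := (leq_card_setU (nbrs U :\: X) (~: nbrs U :\: X)).1; rewrite -h1 => h2.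
  have := cardsID U' (~: nbrs U :\: X).
  have := subset_leq_card (subsetIr (~: nbrs U :\: X) U').
  by rewrite cU'; lia.
- exact: disjoint_setDr.
move: yS; rewrite !inE => /and3P[_ _ /negP]; apply.
by apply/bigcupP; exists x; rewrite ?(subsetP sU') // inE.
Qed.

(** If every choice of [y] fails, each one is blocked by a set where the
    condition is an equality, which has [y] as a neighbour and avoids [x].
    Such tight sets have fewer than [m] elements by joinedness, and are closed
    under union because the number of neighbours is submodular.  Their union
    is then tight and contains all the free neighbours of [x] in its
    neighbourhood, so that adding [x] to it violates the condition. *)
Lemma extendable_step X dem x :
    (forall z, dem z <= D) -> extendable X dem ->
    2 * m * (D + 1) < #|~: X| -> 0 < dem x ->
  exists2 y, y \in nbr x :\: X &
    extendable (y |: X) (fun z => if z == x then (dem z).-1 else dem z).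
Proof.
move=> demD ext bigX demx.
case: (boolP [exists y in nbr x :\: X, [forall U : {set G}, (#|U| <= 2 * m) ==>
  (\sum_(z in U) (if z == x then (dem z).-1 else dem z)
     <= #|nbrs U :\: (y |: X)|)]]).
  move=> /exists_inP[y yx /forallP h]; exists y => // U cU.
  exact: (implyP (h U) cU).
move=> /exists_inPn noy; exfalso.
pose tight U := (#|U| <= 2 * m) && (#|nbrs U :\: X| <= \sum_(z in U) dem z).
have sum_le U : #|U| <= 2 * m -> \sum_(z in U) dem z <= 2 * m * D.
  move=> cU; apply: (@leq_trans (#|U| * D)); last by rewrite leq_mul2r cU orbT.
  by rewrite -sum_nat_const; apply: leq_sum.
have tight_small U : tight U -> #|U| < m.
  case/andP=> cU tU; rewrite ltnNge; apply/negP => mU.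
  have h1 := nbrs_large X mU; have h2 := sum_le _ cU.
  have h3 := leq_trans tU h2; move: bigX; rewrite mulnDr muln1 => bigX.
  have h4 : #|nbrs U :\: X| + 2 * m <= 2 * m * D + 2 * m by rewrite leq_add2r.
  by have := ltn_trans bigX (leq_trans h1 h4); rewrite ltnn.
(* The bound [m] on tight sets keeps their unions within the range [2 * m]. *)
have tightU A B : tight A -> tight B -> tight (A :|: B).
  move=> tA tB; have cA := tight_small _ tA; have cB := tight_small _ tB.
  have cU := (leq_card_setU A B).1.
  have cI := subset_leq_card (subsetIl A B).
  apply/andP; split; first by lia.
  have sumUI : \sum_(z in A :|: B) dem z + \sum_(z in A :&: B) dem z =
     \sum_(z in A) dem z + \sum_(z in B) dem z.
    rewrite (big_setID A) /= setUK setDUl setDv set0U [in RHS]addnC.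
    rewrite [X in _ = X + _](big_setID A) /= setIC; lia.
  have IS : nbrs (A :&: B) :\: X \subset (nbrs A :\: X) :&: (nbrs B :\: X).
    apply/subsetP => y; rewrite !inE => /andP[-> /bigcupP[z]].
    by rewrite inE => /andP[zA zB] e /=; apply/andP; split; apply/bigcupP; exists z.
  have := subset_leq_card IS.
  have := cardsUI (nbrs A :\: X) (nbrs B :\: X).
  rewrite -setDUl -nbrsU => e1 e2.
  have := ext (A :&: B); have := andP tA; have := andP tB.
  move=> [_ tB'] [_ tA'] /(_ _) h.
  have {}h := h ltac:(lia); lia.
pose good U := tight U && (x \notin U).
pose M := \bigcup_(U | good U) U.
have gM : good M.
  rewrite /M; elim/big_ind: _ => //.
    rewrite /good /tight inE cards0 andbT /= /nbrs big_set0 set0D cards0 //.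
  move=> A B /andP[tA xA] /andP[tB xB]; rewrite /good tightU //=.
  by rewrite inE negb_or xA.
case/andP: (gM) => tM xM.
have NxM : nbr x :\: X \subset nbrs M.
  apply/subsetP => y yN; have := noy y yN.
  rewrite negb_forall => /existsP[U]; rewrite negb_imply -ltnNge => /andP[cU hU].
  have eU := ext U cU.
  have xU : x \notin U.
    apply/negP => xU.
    have e1 : \sum_(z in U) dem z =
       (\sum_(z in U) (if z == x then (dem z).-1 else dem z)).+1.
      rewrite (bigD1 x xU) [in RHS](bigD1 x xU) /= eqxx -addSn prednK //.
      by congr (_ + _); apply: eq_bigr => z /andP[_ /negbTE->].
    have : #|nbrs U :\: X| <= #|nbrs U :\: (y |: X)|.+1.
      rewrite -(setDDl) setDDl setUC -setDDl; have := cardsD1 y (nbrs U :\: X).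
      by case: (y \in _) => /=; lia.
    lia.
  have eS : \sum_(z in U) (if z == x then (dem z).-1 else dem z)
            = \sum_(z in U) dem z.
    apply: eq_bigr => z zU; case: eqVneq => // e; by rewrite -e zU in xU.
  rewrite eS in hU.
  have dY : #|nbrs U :\: X| = (y \in nbrs U :\: X) + #|nbrs U :\: (y |: X)|.
    by rewrite (cardsD1 y) setDDl setUC.
  have yU : y \in nbrs U.
    by move: dY; rewrite inE; case: (y \in nbrs U) => //; rewrite andbF; lia.
  have gU : good U.
    rewrite /good xU andbT /tight cU /=.
    by move: dY; case: (y \in _) => /=; lia.
  have /bigcupP[z zU e] := yU; apply/bigcupP; exists z => //.
  by apply/bigcupP; exists U.
have cM := tight_small _ tM.
have := ext (x |: M); rewrite cardsU1 xM big_setU1 //= nbrsU /nbrs big_set1.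
rewrite -/(nbrs M) setDUl.
have -> : nbr x :\: X :|: nbrs M :\: X = nbrs M :\: X.
  apply/setUidPr; apply/subsetP => y yN.
  by rewrite inE (subsetP NxM) // andbT; move: yN; rewrite inE => /andP[].
move/(_ ltac:(lia)); case/andP: tM => _; lia.
Qed.

End FriedmanPippenger.

Lemma in_nbrs (G : sgraph) (C : {set G}) (q : G) :
  reflect (exists2 c, c \in C & edge c q) (q \in nbrs C).
Proof. by apply: (iffP bigcupP) => -[c cC]; rewrite ?inE => e; exists c; rewrite ?inE. Qed.


(** * Rooted trees *)

Record rooting (T : sgraph) := Rooting {
  troot : T;
  par : T -> T;
  dep : T -> nat;
  par_root : par troot = troot;
  dep_par : forall x, x != troot -> dep x = (dep (par x)).+1;
  edge_par : forall x y,
    edge x y = (x != troot) && (par x == y) || (y != troot) && (par y == x) }.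

Lemma exit_edge (T : sgraph) (E : {set T}) (x z : T) :
  connect (@edge T) x z -> x \in E -> z \notin E ->
  exists u v, [/\ u \in E, v \notin E & edge u v].
Proof.
case/connectP => p; elim: p x => [|y p IH] x /=; first by move=> _ -> ->.
case/andP=> exy pth lst xE zE.
case: (boolP (y \in E)) => yE; first exact: (IH y).
by exists x, y.
Qed.

(** A second neighbour in [E] would close a cycle through [y] along a path
    of [E]. *)
Lemma acyclic_unique_nbr (T : sgraph) (E : {set T}) (x x' y : T) :
    acyclic_graph T -> y \notin E -> x \in E -> x' \in E ->
    connect [rel u v | [&& u \in E, v \in E & edge u v]] x x' ->
    edge y x -> edge y x' -> x = x'.
Proof.
move=> acT yE xE xE' /connectP[p0 pth0 lst0] eyx.
case/shortenP: pth0 lst0 => p pth up _ lst eyx'.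
have inE p1 u : u \in E -> path [rel u v | [&& u \in E, v \in E & edge u v]] u p1 ->
    {subset u :: p1 <= E} /\ path (@edge T) u p1.
  elim: p1 u => [|v p1 IH] u uE /=.
    by move=> _; split => // a; rewrite inE => /eqP->.
  case/andP => /and3P[_ vE euv] /(IH v vE)[h ->]; split; last by rewrite euv.
  by move=> a; rewrite inE => /orP[/eqP->|/h].
have [sE pe] := inE _ _ xE pth.
case: p pth up lst sE pe => [|z p] //= pth up lst sE pe.
exfalso; apply: (acT [:: y, x, z & p]) => //.
apply/andP; split.
  rewrite /= eyx /= rcons_path /=.
  by case/andP: pe => -> ->; rewrite /= -lst edge_sym.
rewrite cons_uniq; apply/andP; split; last exact: up.
by apply: contra yE; apply: sE.
Qed.

(** A connected vertex set is grown one vertex at a time from an arbitrary root;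
    the parent of a new vertex is its unique neighbour in the set. *)
Lemma tree_rooting (T : sgraph) : is_tree T -> inhabited (rooting T).
Proof.
case=> [[T0 cT] acT]; have /card_gt0P[r _] := T0.
pose eE (E : {set T}) := [rel u v | [&& u \in E, v \in E & edge u v]].
have step k : k < #|T| -> exists (E : {set T}) (p : T -> T) (d : T -> nat),
    [/\ #|E| = k.+1, r \in E,
     forall x, x \in E -> x != r -> d x = (d (p x)).+1,
     forall x y, x \in E -> y \in E ->
       edge x y = (x != r) && (p x == y) || (y != r) && (p y == x) &
     [/\ p r = r, forall x, x \in E -> p x \in E &
     forall x y, x \in E -> y \in E -> connect (eE E) x y]].
  elim: k => [|k IH] kT.
    exists [set r], id, (fun _ => 0); split.
    - by rewrite cards1.
    - by rewrite inE.
    - by move=> x; rewrite inE => /eqP->; rewrite eqxx.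
    - by move=> x y /set1P-> /set1P->; rewrite eqxx edge_irrefl.
    - by split=> // x y /set1P-> /set1P->; apply: connect0.
  have [|E [p [d [cE rE dE eP [pr pE cnE]]]]] := IH; first exact: ltnW.
  have [z zE] : exists z, z \notin E.
    apply/existsP; rewrite -negb_forall; apply/negP => /forallP h.
    have : #|T| <= #|E| by rewrite -cardsT subset_leq_card //; apply/subsetP.
    by rewrite cE leqNgt kT.
  have [x [y [xE yE exy]]] := exit_edge (cT r z) rE zE.
  have yr : y != r by apply: contraNneq yE => ->.
  have nx x' : x' \in E -> edge x' y = (x == x').
    move=> xE'; apply/idP/eqP => [e|<- //].
    apply: (acyclic_unique_nbr acT yE xE xE' (cnE _ _ xE xE')).
      by rewrite edge_sym.
    by rewrite edge_sym.
  exists (y |: E), (fun u => if u == y then x else p u),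
    (fun u => if u == y then (d x).+1 else d u).
  have ny u : u \in E -> (u == y) = false.
    by move=> uE; apply/negbTE; apply: contraNneq yE => <-.
  split.
  - by rewrite cardsU1 yE cE.
  - by rewrite inE rE orbT.
  - move=> u; rewrite !inE; case: (eqVneq u y) => [-> _ _|nu /= uE ur].
      by rewrite ny.
    by rewrite ny ?pE // dE.
  - move=> u v; rewrite !inE; case: (eqVneq u y) => [->|nu] /=;
      case: (eqVneq v y) => [->|nv] //= uE vE.
    + by rewrite edge_irrefl yr ny.
    + rewrite edge_sym nx // yr /=; case: eqVneq => //= _.
      by rewrite ny ?andbF // pE.
    + by rewrite nx // yr ny ?andbF ?pE.
    + exact: eP.
  - split.
      by rewrite ny.
      move=> u; rewrite !inE; case: (eqVneq u y) => [_ _|_ /= uE].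
        by rewrite xE orbT.
      by rewrite pE // orbT.
    have sub u v : connect (eE E) u v -> connect (eE (y |: E)) u v.
      apply: connect_sub => a b /and3P[aE bE eab]; apply: connect1.
      by rewrite /= !inE aE bE eab !orbT.
    have cy : connect (eE (y |: E)) x y.
      by apply: connect1; rewrite /= !inE xE eqxx exy !orbT.
    have cy' : connect (eE (y |: E)) y x.
      by apply: connect1; rewrite /= !inE xE eqxx edge_sym exy !orbT.
    move=> u v; rewrite !inE => /orP[/eqP->|uE] /orP[/eqP->|vE].
    + exact: connect0.
    + exact: connect_trans cy' (sub _ _ (cnE _ _ xE vE)).
    + exact: connect_trans (sub _ _ (cnE _ _ uE xE)) cy.
    + exact: sub (cnE _ _ uE vE).
have [|E [p [d [cE rE dE eP [pr _ _]]]]] := step #|T|.-1; first by rewrite prednK.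
have EE x : x \in E.
  have /eqP-> : E == setT by rewrite eqEcard subsetT cardsT cE prednK // leqnn.
  by rewrite inE.
constructor; apply: (@Rooting T r p d pr) => [x|x y]; [exact: dE | exact: eP].
Qed.

Section Rooted.

Variables (T : sgraph) (R : rooting T).
Local Notation r := (troot R).
Local Notation p := (par R).
Local Notation d := (dep R).
Implicit Types (x y z : T) (E : {set T}).

Lemma edge_parent x : x != r -> edge x (p x).
Proof. by move=> xr; rewrite (edge_par R) xr eqxx. Qed.

Lemma edge_parent_l x : x != r -> edge (p x) x.
Proof. by rewrite edge_sym; apply: edge_parent. Qed.

Lemma edge_odd x y : edge x y -> odd (d x) = ~~ odd (d y).
Proof.
rewrite (edge_par R) => /orP[] /andP[h /eqP <-]; rewrite (dep_par h) //=.
by rewrite negbK.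
Qed.

(** A tree has no cycle of length 4. *)
Lemma common_nbr_unique x y q q' : x != y ->
  edge x q -> edge y q -> edge x q' -> edge y q' -> q = q'.
Proof.
move=> xy; rewrite !(edge_par R).
case/orP=> /andP[/dep_par + /eqP e1]; rewrite ?e1 => d1.
all: case/orP=> /andP[/dep_par + /eqP e2]; rewrite ?e2 => d2.
all: case/orP=> /andP[/dep_par + /eqP e3]; rewrite ?e3 => d3.
all: case/orP=> /andP[/dep_par + /eqP e4]; rewrite ?e4 => d4.
all: try lia; try congruence.
all: by case/eqP: xy; congruence.
Qed.

Lemma edge_dep x y : edge x y -> d x = (d y).+1 \/ d y = (d x).+1.
Proof.
by rewrite (edge_par R) => /orP[] /andP[h /eqP <-]; rewrite (dep_par h); auto.
Qed.

Lemma nbr_par x y : edge x y -> y != p x -> y != r /\ p y = x.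
Proof.
by rewrite (edge_par R) => /orP[] /andP[h /eqP <-] //; rewrite eqxx.
Qed.

Definition downclosed E := r \in E /\ forall x, x \in E -> p x \in E.

Lemma downclosed_cross E x y : downclosed E -> x \notin E -> y \in E -> edge x y ->
  y = p x.
Proof.
case=> rE dE xE yE; rewrite (edge_par R) => /orP[] /andP[h /eqP e] //.
by rewrite -e dE in xE.
Qed.

Lemma downclosed_iter E x j k : downclosed E -> j <= k ->
  iter k p x \notin E -> iter j p x \notin E.
Proof.
case=> rE dE jk; apply: contra => h; rewrite -(subnK jk) iterD.
by elim: (k - j) => //= i; apply: dE.
Qed.

Lemma downclosed_notin_root E x : downclosed E -> x \notin E -> x != r.
Proof. by case=> rE _; apply: contraNneq => ->. Qed.

Lemma downclosed_boundary E x : downclosed E -> x \notin E ->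
  exists2 y, y \notin E & p y \in E.
Proof.
move=> dE; have [n] := ubnP (d x); elim: n x => // n IH x dx xE.
case: (boolP (p x \in E)) => pE; first by exists x.
apply: (IH (p x)) => //.
by move: dx; rewrite (dep_par (downclosed_notin_root dE xE)).
Qed.

(** The vertices within distance [k] of [E] number at most [#|E| * (D + 1) ^ k],
    so some vertex is farther away; its ancestors are followed up to [E].
    This is what makes room for the gadgets: a gadget around such a vertex
    touches [E] only through the path that links it. *)
Lemma far_vertex E D k :
    (forall x, #|nbr x| <= D) -> downclosed E -> #|E| * (D + 1) ^ k < #|T| ->
  exists2 x, iter k.+1 p x \in E & iter k p x \notin E.
Proof.
move=> hD; elim: k E => [|k IH] E dE cE.
  have [x xE] : exists x, x \notin E.
    apply/existsP; rewrite -negb_forall; apply/negP => /forallP h.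
    have : #|T| <= #|E| by rewrite -cardsT subset_leq_card //; apply/subsetP.
    lia.
  by have [y ? ?] := downclosed_boundary dE xE; exists y.
have dE' : downclosed (E :|: nbrs E).
  case: dE => rE dE; split; first by rewrite inE rE.
  move=> x; rewrite !inE => /orP[xE|/bigcupP[y yE]]; first by rewrite dE.
  rewrite inE => e; case: (eqVneq (p x) y) => [->|h]; first by rewrite yE.
  move: e h; rewrite (edge_par R) => /orP[] /andP[_ /eqP e]; last by rewrite e eqxx.
  by rewrite -e !dE.
have [|x xE' nxE'] := IH _ dE'.
  apply: leq_ltn_trans cE; rewrite expnS mulnA leq_mul2r; apply/orP; right.
  apply: leq_trans (leq_card_setU _ _) _.
  by rewrite mulnDr muln1 addnC leq_add2r /nbrs; apply: leq_card_bigcup.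
set z := iter k p x in nxE'; have zr : z != r := downclosed_notin_root dE' nxE'.
have yE : p z \notin E.
  apply: contra nxE' => h; rewrite inE; apply/orP; right.
  by apply/bigcupP; exists (p z); rewrite // inE edge_parent_l.
exists x => //; move: xE'; rewrite iterS -/z inE (negbTE yE) /=.
case/bigcupP => u uE; rewrite inE edge_sym => e.
by rewrite /= -/z -(downclosed_cross dE yE uE e).
Qed.

End Rooted.

(** * Partial embeddings *)

Section PartialEmbedding.

Variables (G T : sgraph).
Implicit Types (A B : {set T}) (f g : T -> G) (F : {set G}).

(** [F] is a set of reserved vertices of the host, which the embedding must
    avoid.  The map is total so that its restriction to [A] can be changed
    without dependent types; its values outside [A] are irrelevant. *)
Definition partial_emb A f F :=
  [/\ {in A &, injective f}, {in A, forall a, f a \notin F} &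
      {in A &, forall x y, edge x y -> edge (f x) (f y)}].

Definition occupied A f F : {set G} := f @: A :|: F.

Definition glue B g f : T -> G := fun x => if x \in B then g x else f x.

Lemma glueE B g f x : x \in B -> glue B g f x = g x.
Proof. by rewrite /glue => ->. Qed.

Lemma glueEr A B g f x : [disjoint A & B] -> x \in A -> glue B g f x = f x.
Proof. by rewrite /glue => dAB xA; rewrite (disjointFr dAB xA). Qed.

Lemma card_occupied A f F : #|occupied A f F| <= #|A| + #|F|.
Proof.
apply: leq_trans (leq_card_setU _ _) _; rewrite leq_add2r; exact: leq_imset_card.
Qed.

Lemma card_occupiedE A f F : partial_emb A f F -> #|occupied A f F| = #|A| + #|F|.
Proof.
case=> fi fF _; rewrite cardsU (card_in_imset fi).
have -> : f @: A :&: F = set0; last by rewrite cards0 subn0.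
apply/eqP; rewrite -subset0; apply/subsetP => y; rewrite inE => /andP[/imsetP[a aA ->]].
by rewrite (negbTE (fF a aA)).
Qed.

Lemma partial_emb_glue A f F B g F' :
    partial_emb A f F -> [disjoint A & B] -> {in B &, injective g} ->
    {in A, forall a, f a \notin F'} ->
    {in B, forall x, g x \notin occupied A f F'} ->
    {in B &, forall x y, edge x y -> edge (g x) (g y)} ->
    {in B & A, forall x y, edge x y -> edge (g x) (f y)} ->
  partial_emb (A :|: B) (glue B g f) F'.
Proof.
move=> [fi _ fe] dAB gi fF' gocc ge gfe.
have gA x a : x \in B -> a \in A -> g x <> f a.
  move=> xB aA e; have := gocc x xB; rewrite e inE negb_or => /andP[/negP + _].
  by apply; apply/imsetP; exists a.
split.
- move=> x y; rewrite !inE /glue.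
  case: (boolP (x \in B)) => xB; case: (boolP (y \in B)) => yB;
    rewrite ?orbF ?orbT => xA yA.
  + exact: gi.
  + by move/gA; case.
  + by move/esym/gA; case.
  + exact: fi.
- move=> x; rewrite inE /glue; case: (boolP (x \in B)) => xB.
    by move=> _; have := gocc x xB; rewrite inE negb_or => /andP[].
  by rewrite orbF => /fF'.
- move=> x y; rewrite !inE /glue.
  case: (boolP (x \in B)) => xB; case: (boolP (y \in B)) => yB;
    rewrite ?orbF ?orbT => xA yA.
  + exact: ge.
  + exact: gfe.
  + by rewrite edge_sym => /gfe h; rewrite edge_sym h.
  + exact: fe.
Qed.

Lemma partial_emb_sub A f F F' : F' \subset F -> partial_emb A f F -> partial_emb A f F'.
Proof.
move=> sF [fi fF fe]; split=> // a aA; apply: contra (fF a aA); exact: (subsetP sF).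
Qed.

(** A gadget embedded away from the rest of the tree is attached to it by a path
    through two new vertices: the free neighbours of the images of both ends
    are joined by an edge. *)
Lemma partial_emb_link A f F (m : nat) y c z1 z2 :
    joined G m -> partial_emb A f F ->
    (forall x : G, 2 * m <= #|nbr x :\: occupied A f F|) ->
    y \in A -> c \in A -> z1 \notin A -> z2 \notin A -> z1 != z2 ->
    {in A, forall a, edge z1 a -> a = y} ->
    {in A, forall a, edge z2 a -> a = c} ->
  exists2 f', {in A, f' =1 f} & partial_emb (A :|: [set z1; z2]) f' F.
Proof.
move=> Gm pA big yA cA z1A z2A nz h1 h2.
have [||a [b [aS bS ab]]] := joined_overlap Gm
    (S := nbr (f y) :\: occupied A f F) (S' := nbr (f c) :\: occupied A f F).
- by have := big (f y); lia.
- exact: big.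
have dA : [disjoint A & [set z1; z2]].
  rewrite disjoint_sym; apply/pred0P => x /=; rewrite !inE.
  by case: eqP => [->|]; [rewrite (negbTE z1A)|case: eqP => // ->; rewrite (negbTE z2A)].
exists (glue [set z1; z2] (fun x => if x == z1 then a else b) f).
  by move=> x xA; rewrite (glueEr _ _ dA).
have nab : a != b by apply: contraTneq ab => ->; rewrite edge_irrefl.
move: aS bS; rewrite !in_setD !in_nbr => /andP[aO ea] /andP[bO eb].
have nz' : (z2 == z1) = false by rewrite eq_sym (negbTE nz).
apply: (partial_emb_glue pA) => //.
- move=> u v /set2P[] -> /set2P[] ->; rewrite ?eqxx ?nz' // => e.
    by rewrite e eqxx in nab.
  by rewrite e eqxx in nab.
- by case: pA.
- by move=> u /set2P[] ->; rewrite ?eqxx ?nz'.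
- move=> u v /set2P[] -> /set2P[] ->; rewrite ?eqxx ?nz' ?edge_irrefl // => _.
  by rewrite edge_sym.
- move=> u v /set2P[] -> vA; rewrite ?eqxx ?nz'.
    by move/(h1 _ vA) => ->; rewrite edge_sym.
  by move/(h2 _ vA) => ->; rewrite edge_sym.
Qed.

End PartialEmbedding.

(** * Absorbing stars *)

(** A star centred at [s] outside [X] whose leaves are all adjacent to a constant
    fraction of the host vertices, in terms of the weight [w].  The centre [s] is
    chosen first, so that a constant fraction of the vertices [v] has many
    common neighbours with [s]; this is possible because at least [h ^ 2] paths
    of length two avoiding [X] start at any given [v].  The leaves then come
    from [pick_common]. *)
Lemma pick_star (G : sgraph) (V : eqType) (l : seq V) (w : G -> nat) (X : {set G})
    (h b B : nat) :
    uniq l -> 0 < b -> 2 * (b + size l) * #|G| <= h ^ 2 -> #|G| <= B * b ->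
    (forall x : G, h <= #|nbr x :\: X|) -> 0 < #|G| ->
  exists (s : G) (g : V -> G), [/\ s \notin X, {in l &, injective g},
    {in l, forall x, (g x \notin X) && edge s (g x)} &
    \sum_v w v <= B ^ (size l).+1 * \sum_(v | all (fun x => edge v (g x)) l) w v].
Proof.
move=> ul b0 bh Bb hX G0; set n := #|G| in bh Bb G0 *.
have hn : h <= n.
  have /card_gt0P[x _] := G0; apply: leq_trans (hX x) _; exact: max_card.
have bh' : b + size l <= h.
  have h1 : 2 * (b + size l) * n <= h * n by rewrite (leq_trans bh) // -mulnn leq_mul2l hn orbT.
  move: h1; rewrite leq_mul2r; case/orP; [move/eqP; lia | lia].
pose R v s := b + size l <= #|nbr v :&: (nbr s :\: X)|.
have good v : b <= #|[set s in ~: X | R v s]|.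
  rewrite leqNgt; apply/negP => lt_b.
  (* Both bounds count the paths of length two from [v] that avoid [X]. *)
  have lo : h ^ 2 <= \sum_(s in ~: X) #|nbr v :&: (nbr s :\: X)|.
    have -> : \sum_(s in ~: X) #|nbr v :&: (nbr s :\: X)|
         = \sum_(s in ~: X) \sum_(x in nbr v :\: X | edge s x) 1.
      apply: eq_bigr => s _; rewrite -sum1_card; apply: eq_bigl => x.
      by rewrite !inE; case: (x \in X); rewrite /= ?andbF ?andbT.
    rewrite (exchange_big_dep (mem (nbr v :\: X))) /=; last by move=> s x _ /andP[].
    rewrite -mulnn; apply: (@leq_trans (\sum_(x in nbr v :\: X) h)).
      by rewrite sum_nat_const leq_mul2r hX orbT.
    apply: leq_sum => x xv; apply: leq_trans (hX x) _; rewrite -sum1_card.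
    apply: eq_leq; apply: eq_bigl => s.
    by rewrite xv !inE edge_sym.
  have hi : \sum_(s in ~: X) #|nbr v :&: (nbr s :\: X)|
            <= #|[set s in ~: X | R v s]| * n + n * (b + size l).
    rewrite (bigID (R v)) /=; apply: leq_add.
      apply: (@leq_trans (\sum_(s in [set s in ~: X | R v s]) n)).
        have -> : \sum_(i in ~: X | R v i) #|nbr v :&: (nbr i :\: X)|
            = \sum_(i in [set s in ~: X | R v s]) #|nbr v :&: (nbr i :\: X)|.
          by apply: eq_bigl => s; rewrite inE.
        by apply: leq_sum => s _; apply: max_card.
      by rewrite sum_nat_const.
    apply: (@leq_trans (\sum_(s in ~: X | ~~ R v s) (b + size l))).
      by apply: leq_sum => s /andP[_]; rewrite /R -ltnNge => /ltnW.
    rewrite sum_nat_cond_const leq_mul2r; apply/orP; right; exact: max_card.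
  have := leq_trans bh (leq_trans lo hi).
  have : #|[set s in ~: X | R v s]| * n + n <= b * n by rewrite -mulSnr leq_mul2r lt_b orbT.
  nia.
have [|||s sX hs] := @averaging _ _ R w setT (~: X) b B.
- have /card_gt0P[x _] := G0; have := good x; have := max_card [set s in ~: X | R x s].
  move=> _ h1; apply: leq_trans b0 (leq_trans h1 _); apply: subset_leq_card.
  by apply/subsetP => y; rewrite inE => /andP[].
- by apply: leq_trans Bb; apply: max_card.
- by move=> z _; apply: good.
have [|||g [gi gC hg]] := pick_common (l := l) w (Z := [set z | R z s])
    (C := nbr s :\: X) (B := B) ul b0.
- by apply: leq_trans (hX s).
- by apply: leq_trans Bb; apply: max_card.
- by move=> z; rewrite inE.
exists s, g; split=> //.
- by rewrite inE in sX.
- by move=> x /gC; rewrite !inE.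
- have -> : \sum_v w v = \sum_(z in setT) w z by apply: eq_bigl => z; rewrite inE.
  apply: leq_trans hs _; rewrite expnS -mulnA leq_mul2l; apply/orP; right.
  have -> : \sum_(z in [set: G] | R z s) w z = \sum_(z in [set z | R z s]) w z.
    by apply: eq_bigl => z; rewrite !inE.
  apply: leq_trans hg _; rewrite leq_mul2l; apply/orP; right.
  rewrite [in leqRHS](bigID (fun v => R v s)) /=.
  apply: leq_trans (leq_addr _ _); apply: eq_leq; apply: eq_bigl => z.
  by rewrite inE andbC.
Qed.

Section Flipping.

Variables (G T : sgraph).
Implicit Types (A W : {set T}) (f : T -> G).

(** The tree vertices of [W] that can be moved to the host vertex [v] without
    losing an edge to their neighbours. *)
Definition slots f W (v : G) : {set T} := [set w in W | nbr w \subset [set c | edge v (f c)]].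

Lemma eq_slots A f f' W v : {in A, f' =1 f} -> {in W, forall w, nbr w \subset A} ->
  slots f' W v = slots f W v.
Proof.
move=> e sW; apply/setP => w; rewrite !inE; case: (boolP (w \in W)) => //= wW.
have sw := subsetP (sW w wW).
by apply/subsetP/subsetP => s c cw; have := s c cw; rewrite !inE e // sw.
Qed.

(** No two vertices of [W] are adjacent, so any number of them can be moved
    simultaneously. *)
Definition flippable A W :=
  [/\ W \subset A, {in W, forall w, nbr w \subset A} &
      {in W, forall w c, edge w c -> c \notin W}].

Lemma flippable_sub A A' W : A \subset A' -> flippable A W -> flippable A' W.
Proof.
move=> sA [WA nW iW]; split=> //; first exact: subset_trans WA sA.
by move=> w /nW nA; apply: subset_trans nA sA.
Qed.

(** The slots of [v q] whose image may also serve as the image of [q], as far as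
    the neighbours of [q] other than [c] are concerned. *)
Definition anchored_slots W f (v : T -> G) (q c : T) : {set T} :=
  [set w in slots f W (v q) | nbr q :\ c \subset [set a | edge (f w) (f a)]].

Lemma anchored_slots_sub A W f f' (v v' : T -> G) (q c : T) :
    {in A, f' =1 f} -> flippable A W -> nbr q :\ c \subset A -> v q = v' q ->
  anchored_slots W f v q c \subset anchored_slots W f' v' q c.
Proof.
move=> e [WA nW _] sA ev; apply/subsetP => w.
rewrite !(inE, in_set) -ev => /andP[/andP[wW /subsetP h1] /subsetP h2].
rewrite wW /=; apply/andP; split; apply/subsetP => a ha; rewrite inE.
  by have := h1 a ha; rewrite inE e // (subsetP (nW w wW)).
have := h2 a ha; rewrite inE !e //; first by rewrite (subsetP sA).
by rewrite (subsetP WA).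
Qed.

End Flipping.

Lemma bernoulli x k : x ^ k.+1 + k.+1 * x ^ k <= x.+1 ^ k.+1.
Proof.
elim: k => [|k IH]; first by rewrite !expn1 expn0; lia.
rewrite (expnS x.+1); apply: leq_trans (leq_mul (leqnn x.+1) IH).
rewrite !expnS; nia.
Qed.

Lemma double_expn x : 2 * x ^ x.+1 <= x.+1 ^ x.+1.
Proof. have := bernoulli x x; rewrite expnS; nia. Qed.

Section Absorbers.

Variables (G T : sgraph) (R : rooting T) (m D u h b B : nat).
Local Notation r := (troot R).
Local Notation p := (par R).
Local Notation d := (dep R).
Hypothesis Gm : joined G m.
Hypothesis degT : forall x : T, #|nbr x| <= D.
Hypothesis degG : forall x : G, h + u <= #|nbr x|.
Hypothesis mh : 2 * m <= h.
Hypothesis b0 : 0 < b.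
Hypothesis bh : 2 * (b + D) * #|G| <= h ^ 2.
Hypothesis Bb : #|G| <= B * b.
Hypothesis cardGT : #|G| = #|T|.
Hypothesis T_large : u * (D + 1) ^ 5 < #|T|.
Implicit Types (A W : {set T}) (f : T -> G) (F : {set G}).

(** After [i] stars each host vertex [v] has weight [2 ^ (i - s)], where [s] is
    the number of its slots.  The base [B ^ D.+1] is the inverse of the fraction
    of the weight covered by one star. *)
Definition absorbing i A f W :=
  [/\ downclosed R A /\ #|A| <= 1 + i * (D + 4), partial_emb A f set0, flippable A W,
      #|W| <= i &
      (B ^ D.+1) ^ i * (\sum_v 2 ^ (i - #|slots f W v|)) <=
      (2 * B ^ D.+1 - 1) ^ i * #|G|].

(** A star around a tree vertex [w] at distance 4 from [A] is embedded on a host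
    star that covers a constant fraction of the current weight, then linked to
    [A]. *)
Lemma absorbing_step i A f W :
    1 + i.+1 * (D + 4) <= u -> absorbing i A f W ->
  exists A' f' W', absorbing i.+1 A' f' W'.
Proof.
move=> iu [[dA cA] pA [WA nW iW] cW pot].
have Au' : #|A| + (D + 4) <= u by move: iu; rewrite mulSn; lia.
have Au : #|A| <= u by lia.
have n0 : 0 < #|G| by rewrite cardGT; apply: leq_ltn_trans T_large.
have B0 : 0 < B by rewrite lt0n; apply: contraTneq Bb => ->; rewrite mul0n -ltnNge.
have [|w wA wA'] := far_vertex (k := 3) degT dA.
  apply: leq_ltn_trans T_large; apply: leq_mul => //.
  by rewrite leq_pexp2l // addn1.
set z1 := iter 3 p w in wA'; set z2 := iter 2 p w; set c0 := p w.
have nA j : j <= 3 -> iter j p w \notin A.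
  by move=> j3; apply: downclosed_iter dA j3 wA'.
have dj j : j <= 3 -> d (iter j p w) = (d (iter j.+1 p w)).+1.
  move=> j3; rewrite iterS; apply: dep_par.
  exact: downclosed_notin_root dA (nA j j3).
have d0 : d w = (d c0).+1 by apply: (dj 0).
have d1 : d c0 = (d z2).+1 by apply: (dj 1).
have d2 : d z2 = (d z1).+1 by apply: (dj 2).
have w_nA : w \notin A by apply: (nA 0).
have c0_nA : c0 \notin A by apply: (nA 1).
have z2_nA : z2 \notin A by apply: (nA 2).
have wr := downclosed_notin_root dA w_nA.
have nbrw c : edge w c -> c != c0 -> p c = w.
  by move=> e nc; case: (nbr_par e nc).
have par_nA x : x \in w |: nbr w -> p x \notin A.
  rewrite !inE => /orP[/eqP-> //|e].
  by case: (eqVneq x c0) => [-> //|nc]; rewrite (nbrw _ e nc).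
have nbr_nA x : x \in w |: nbr w -> x \notin A.
  by move/par_nA; apply: contra; case: dA => _; apply.
have dAB : [disjoint A & w |: nbr w].
  rewrite disjoint_sym; apply/pred0P => x /=; apply/negP => /andP[xB xA].
  by have := nbr_nA x xB; rewrite xA.
pose l := enum (nbr w).
have sl : size l = #|nbr w| by rewrite -cardE.
have ln x : (x \in l) = edge w x by rewrite mem_enum inE.
have occA : #|occupied A f set0| <= u by rewrite card_occupiedE // cards0 addn0.
have [||||||s [g [sX gi gC gs]]] := @pick_star G T l (fun v => 2 ^ (i - #|slots f W v|))
   (occupied A f set0) h b B.
- exact: enum_uniq.
- exact: b0.
- by apply: leq_trans bh; rewrite leq_mul2r leq_mul2l leq_add2l sl degT !orbT.
- exact: Bb.
- by move=> x; apply: free_nbrs degG _.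
- exact: n0.
pose g1 x := if x == w then s else g x.
have nww x : edge w x -> (x == w) = false.
  by move=> e; apply/negbTE; apply: contraTneq e => ->; rewrite edge_irrefl.
have g1w : g1 w = s by rewrite /g1 eqxx.
have g1n x : edge w x -> g1 x = g x by move=> e; rewrite /g1 nww.
have sg x : edge w x -> edge s (g x) by rewrite -ln => /gC/andP[].
pose A1 := A :|: (w |: nbr w); pose f1 := glue (w |: nbr w) g1 f.
have pA1 : partial_emb A1 f1 set0.
  apply: (partial_emb_glue pA) => //.
  - move=> x y; rewrite !inE => /orP[/eqP->|ex] /orP[/eqP->|ey] //.
    + rewrite g1w g1n // => e; have := sg _ ey.
      by rewrite -e edge_irrefl.
    + rewrite g1w g1n // => e; have := sg _ ex.
      by rewrite e edge_irrefl.
    + by rewrite !g1n //; apply: gi; rewrite ln.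
  - by move=> a _; rewrite inE.
  - move=> x; rewrite in_setU1 in_nbr => /orP[/eqP->|ex]; first by rewrite g1w.
    rewrite g1n //; rewrite -ln in ex; by case/andP: (gC x ex).
  - move=> x y; rewrite !inE => /orP[/eqP->|ex] /orP[/eqP->|ey] //.
    + by rewrite edge_irrefl.
    + by move=> _; rewrite g1w g1n //; apply: sg.
    + by move=> _; rewrite g1w g1n // edge_sym; apply: sg.
    + move=> exy; have := edge_odd R exy; have := edge_odd R ex; have := edge_odd R ey.
      by do 3 case: odd.
  - move=> x y xB yA e; exfalso.
    have xA : x \notin A by apply: nbr_nA.
    by have := par_nA x xB; rewrite -(downclosed_cross dA xA yA e) yA.
have cA1 : #|A1| <= #|A| + D.+1.
  apply: leq_trans (leq_card_setU _ _) _; rewrite leq_add2l.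
  by rewrite cardsU1 inE edge_irrefl add1n ltnS degT.
have dep_nbr x : edge w x -> d x = (d c0) \/ d x = (d w).+1.
  case/(edge_dep R); clear -d0; lia.
have z_nB z j : z = iter j p w -> j = 2 \/ j = 3 -> z \notin w |: nbr w.
  move=> ->; rewrite !inE => jj; apply/norP; split.
    by apply/eqP => e; move: (congr1 d e); case: jj => ->; rewrite -/z1 -/z2; clear -d0 d1 d2; lia.
  by apply/negP => /dep_nbr; case: jj => ->; rewrite -/z1 -/z2; clear -d0 d1 d2; lia.
have z1B : z1 \notin w |: nbr w by apply: (z_nB _ 3) => //; right.
have z2B : z2 \notin w |: nbr w by apply: (z_nB _ 2) => //; left.
have [||||||||f2 ef2 pf2] := partial_emb_link (y := iter 4 p w) (c := c0) (z1 := z1) (z2 := z2) Gm pA1.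
- move=> x; apply: leq_trans mh _; apply: free_nbrs degG _.
  by rewrite card_occupiedE // cards0 addn0 (leq_trans cA1) //; clear -Au'; lia.
- by rewrite inE wA.
- by rewrite !inE edge_parent // !orbT.
- by rewrite inE (negbTE wA').
- by rewrite inE (negbTE z2_nA).
- by apply/eqP => e; have := congr1 d e; clear -d2; lia.
- move=> a; rewrite inE => /orP[aA e|aB e].
    by rewrite (downclosed_cross dA wA' aA e).
  exfalso; move: aB; rewrite !inE => /orP[/eqP ea|/dep_nbr]; case: (edge_dep R e); rewrite ?ea; clear -d0 d1 d2; lia.
- move=> a; rewrite inE => /orP[aA e|aB e].
    by exfalso; have := downclosed_cross dA z2_nA aA e; move=> ea; rewrite ea -/z1 (negbTE wA') in aA.
  move: aB; rewrite !inE => /orP[/eqP ea|ew].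
    by exfalso; case: (edge_dep R e); rewrite ?ea; clear -d0 d1 d2; lia.
  case: (eqVneq a c0) => // nc; exfalso.
  have := nbrw _ ew nc; have [ar pa] := nbr_par ew nc.
  by have := dep_par ar; rewrite pa => da; case: (edge_dep R e); clear -d0 d1 d2 da; lia.
have e2 x : edge w x -> f2 x = g x.
  move=> e; rewrite ef2; last by rewrite !inE e !orbT.
  by rewrite /f1 glueE ?g1n // !inE e orbT.
have e2A : {in A, f2 =1 f}.
  by move=> x xA; rewrite ef2 ?inE ?xA // /f1 (glueEr _ _ dAB).
have wW : w \notin W by apply: contra w_nA; apply: (subsetP WA).
exists (A1 :|: [set z1; z2]), f2, (w |: W); split.
- split.
    split; first by case: dA => rA _; rewrite !inE rA.
    move=> x; rewrite [x \in _]inE => /orP[|/set2P[]->]; last 2 first.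
    + by rewrite !inE wA.
    + by rewrite !inE eqxx !orbT.
    rewrite inE => /orP[xA|]; first by case: dA => _ dA; rewrite !inE dA.
    rewrite !inE => /orP[/eqP->|ex]; first by rewrite edge_parent // !orbT.
    case: (eqVneq x c0) => [->|nc]; first by rewrite eqxx !orbT.
    by rewrite (nbrw _ ex nc) eqxx !orbT.
  apply: leq_trans (leq_card_setU _ _) _.
  have : #|[set z1; z2]| <= 2 by rewrite cards2; case: (_ != _).
  by rewrite mulSn; clear -cA1 cA; lia.
- exact: pf2.
- split.
  + apply/subsetP => x; rewrite !inE => /orP[/eqP->|/(subsetP WA)->] //.
    by rewrite eqxx !orbT.
  + move=> x /setU1P[->|xW]; apply/subsetP => y; first by rewrite !inE => ->; rewrite !orbT.
    by move/(subsetP (nW x xW)); rewrite !inE => ->.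
  + move=> x /setU1P[->|xW] y exy; rewrite !inE; apply/norP; split.
    * by rewrite nww.
    * apply: contra (nbr_nA y _); last by rewrite !inE exy orbT.
      exact: (subsetP WA).
    * apply: contraNneq w_nA => <-.
      by apply: (subsetP (nW x xW)); rewrite inE.
    * exact: iW exy.
- by rewrite cardsU1 wW add1n ltnS.
pose cov v := all (fun x => edge v (g x)) l.
have D' v : #|slots f2 (w |: W) v| = cov v + #|slots f W v|.
  rewrite -(eq_slots (A := A) v e2A) //.
  have -> : cov v = (w \in slots f2 (w |: W) v).
    rewrite !inE eqxx /=; apply/allP/subsetP => hv x.
      by rewrite in_nbr => e; rewrite inE e2 //; apply: hv; rewrite ln.
    by rewrite ln => e; have := hv x; rewrite !inE e2 //; apply.
  rewrite (cardsD1 w); congr (_ + #|pred_of_set _|); apply/setP => x; rewrite !inE.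
  by case: eqVneq => // ->; rewrite (negbTE wW).
have dW v : #|slots f W v| <= i.
  apply: leq_trans cW; apply: subset_leq_card; apply/subsetP => x.
  by rewrite inE => /andP[].
set Q := B ^ D.+1 in pot *.
have Q0 : 0 < Q by rewrite expn_gt0 B0.
have gsQ : \sum_v 2 ^ (i - #|slots f W v|) <= Q * \sum_(v | cov v) 2 ^ (i - #|slots f W v|).
  apply: leq_trans gs _; rewrite leq_mul2r; apply/orP; right.
  by rewrite leq_pexp2l // ltnS sl.
(* All exponents grow by one, and those of the covered vertices then drop by
   one: only the uncovered weights double. *)
have potS : \sum_v 2 ^ (i.+1 - #|slots f2 (w |: W) v|) + \sum_(v | cov v) 2 ^ (i - #|slots f W v|)
    = 2 * \sum_v 2 ^ (i - #|slots f W v|).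
  rewrite big_distrr /= [X in _ + X]big_mkcond -big_split /=; apply: eq_bigr => v _.
  rewrite D'; case: (cov v); rewrite ?add1n ?add0n.
    by rewrite subSS mul2n addnn.
  by rewrite addn0 subSn // expnS.
rewrite (expnS Q) (expnS (2 * Q - 1)).
move: pot gsQ potS; set S1 := \sum_v _; set S2 := \sum_v _; set S3 := \sum_(v | _) _.
move=> pot gsQ potS.
have hQ : Q * S2 <= (2 * Q - 1) * S1.
  have e : Q * S2 + Q * S3 = 2 * Q * S1 by rewrite -mulnDr potS mulnCA mulnA.
  rewrite mulnBl mul1n -(leq_add2r S1) subnK -?e ?leq_add2l //.
  by rewrite (leq_trans gsQ) // leq_addl.
rewrite -mulnA mulnCA; apply: (@leq_trans (Q ^ i * ((2 * Q - 1) * S1))).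
  by rewrite leq_mul2l hQ orbT.
by rewrite mulnCA -mulnA leq_mul2l pot orbT.
Qed.

(** A vertex with fewer than [g] slots would alone weigh more than [2 ^ (t - g)]
    at the end, whereas the total weight, initially [#|G|], is at most
    [(2 - 1 / Q) ^ t * #|G|], where [Q] is [B ^ D.+1].  For
    [t = 2 * Q * (g + l)] Bernoulli's inequality bounds the latter by
    [2 ^ (t - g - l) * #|G|]. *)
Lemma absorbers_exist g l :
    #|G| < 2 ^ l ->
    let t := 2 * B ^ D.+1 * (g + l) in
    1 + t * (D + 4) <= u ->
  exists A f W, [/\ downclosed R A, #|A| <= 1 + t * (D + 4), partial_emb A f set0,
    flippable A W & forall v, g <= #|slots f W v| ].
Proof.
move=> Gl t tu.
have n0 : 0 < #|G| by rewrite cardGT; apply: leq_ltn_trans T_large.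
have /card_gt0P[x0 _] := n0.
have : exists A f W, absorbing t A f W.
  have : t <= t by [].
  elim: {1 3}t => [|i IH] it.
    exists [set r], (fun _ => x0), set0; split.
    - split; last by rewrite cards1.
      by split=> [|x]; rewrite !inE // => /eqP->; rewrite par_root.
    - split=> [x y /set1P-> /set1P-> //|x _|x y /set1P-> /set1P->].
        by rewrite inE.
      by rewrite edge_irrefl.
    - by split=> [|w|w]; rewrite ?sub0set // inE.
    - by rewrite cards0.
    - by rewrite !expn0 !mul1n (eq_bigr (fun _ => 1)) ?sum1_card // => v _; rewrite sub0n.
  have [A [f [W hA]]] := IH (ltnW it).
  have iu : 1 + i.+1 * (D + 4) <= u.
    by apply: leq_trans tu; rewrite leq_add2l leq_mul2r it orbT.
  exact: (absorbing_step iu hA).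
move=> [A [f [W [[dA cA] pA fW cW pot]]]]; exists A, f, W; split=> // v.
rewrite leqNgt; apply/negP => lt_g.
set Q := B ^ D.+1 in t tu cA cW pot *.
have B0 : 0 < B by rewrite lt0n; apply: contraTneq Bb => ->; rewrite mul0n -ltnNge.
have Q0 : 0 < Q by rewrite expn_gt0 B0.
have gt : g <= t.
  by apply: leq_trans (leq_addr l g) (leq_pmull _ _); rewrite muln_gt0.
have h1 : 2 ^ (t - g) <= \sum_v 2 ^ (t - #|slots f W v|).
  rewrite (bigD1 v) //=; apply: leq_trans (leq_addr _ _).
  by rewrite leq_pexp2l // leq_sub2l // ltnW.
have h2 : (2 * Q) ^ t <= (2 * Q - 1) ^ t * #|G| * 2 ^ g.
  have -> : (2 * Q) ^ t = Q ^ t * 2 ^ (t - g) * 2 ^ g.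
    by rewrite expnMn mulnC -mulnA -expnD subnK.
  by rewrite leq_mul2r (leq_trans _ pot) ?orbT // leq_mul2l h1 orbT.
have h3 : 2 ^ (g + l) * (2 * Q - 1) ^ t <= (2 * Q) ^ t.
  rewrite /t !(expnM _ (2 * Q)) -expnMn.
  case: (posnP (g + l)) => [->|gl]; first by rewrite !expn0.
  rewrite leq_exp2r //.
  by have := double_expn (2 * Q - 1); rewrite subn1 prednK // muln_gt0.
have Qt : 0 < (2 * Q - 1) ^ t by rewrite expn_gt0; apply/orP; left; lia.
have := leq_trans h3 h2; rewrite expnD mulnC -mulnA (mulnC #|G|) leq_pmul2l //.
rewrite leq_pmul2l ?expn_gt0 // leqNgt; by rewrite Gl.
Qed.

End Absorbers.


(** * Gaps *)

Section Gaps.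

Variables (G T : sgraph) (R : rooting T) (m D u h b B L : nat).
Local Notation r := (troot R).
Local Notation p := (par R).
Local Notation d := (dep R).
Hypothesis Gm : joined G m.
Hypothesis degT : forall x : T, #|nbr x| <= D.
Hypothesis degG : forall x : G, h + u <= #|nbr x|.
Hypothesis mh : 2 * m <= h.
Hypothesis b0 : 0 < b.
Hypothesis bh : b + D <= h.
Hypothesis Bb : #|G| <= B * b.
Hypothesis cardGT : #|G| = #|T|.
Hypothesis T_large : u * (D + 1) ^ 5 < #|T|.
Variable W : {set T}.
Implicit Types (A C : {set T}) (f : T -> G) (F : {set G}) (v : T -> G).

(** The gaps are the closed neighbourhoods of the centres in [C]; with [A] they
    form the part of the tree already treated. *)
Definition touched (A C : {set T}) : {set T} := A :|: C :|: nbrs C.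

(** [nbrs C] consists of the neighbours of the centres; [v] reserves one host
    vertex for each of them.  Together with the disjointness conditions, the last
    clause makes the gaps stars without common or adjacent vertices. *)
Definition gapped (A : {set T}) (f : T -> G) (C : {set T}) (v : T -> G) :=
  [/\ partial_emb A f (v @: nbrs C), {in nbrs C &, injective v},
      [disjoint A & C], [disjoint C & nbrs C] &
      {in C, forall c q, edge c q ->
        [/\ q \notin A, nbr q :\ c \subset A & L <= #|anchored_slots W f v q c|]}].

(** Any free vertex [v] may be reserved, since every vertex has many slots.  Each
    slot image has a linear number of free neighbours, so [pick_common] finds
    anchors adjacent to a constant fraction of the slots of [v]. *)
Lemma reserve_special A f F q c g :
    partial_emb A f F -> flippable A W -> #|occupied A f F| < u ->
    [disjoint A & nbr q :\ c] ->
    {in nbr q :\ c, forall x a, a \in A -> ~~ edge x a} ->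
    {in nbr q :\ c &, forall x y, ~~ edge x y} ->
    B ^ D * L <= g -> (forall v : G, g <= #|slots f W v|) ->
  exists (v : G) f', [/\ v \notin F, {in A, f' =1 f},
    partial_emb (A :|: (nbr q :\ c)) f' (v |: F) &
    L <= #|anchored_slots W f' (fun _ => v) q c|].
Proof.
move=> pA fW ou dN eN eNN BL gW; case: (fW) => WA nW _; case: (pA) => fi fF fe.
have B0 : 0 < B.
  rewrite lt0n; apply: contraTneq Bb => ->; rewrite mul0n -ltnNge cardGT.
  exact: leq_ltn_trans T_large.
have [v vO] : exists v : G, v \notin occupied A f F.
  apply/existsP; rewrite -negb_forall; apply/negP => /forallP hO.
  have c1 : #|G| <= #|occupied A f F|.
    by rewrite -cardsT subset_leq_card //; apply/subsetP.
  have c2 : u < #|T| by apply: leq_ltn_trans T_large; rewrite leq_pmulr // expn_gt0 addn1.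
  by move: (leq_ltn_trans c1 ou); rewrite cardGT ltnNge ltnW.
pose l := enum (nbr q :\ c).
have ln x : (x \in l) = (x \in nbr q :\ c) by rewrite mem_enum.
have sl : size l <= D.
  by rewrite -cardE; apply: leq_trans (degT q); rewrite subset_leq_card // subsetDl.
have Xu : #|v |: occupied A f F| <= u by rewrite cardsU1 vO.
have [||||k [ki kC hk]] := pick_common (l := l) (fun _ => 1) (Z := f @: slots f W v)
    (C := ~: (v |: occupied A f F)) (B := B) _ b0.
- exact: enum_uniq.
- apply: (@leq_trans h); first by apply: leq_trans bh; rewrite leq_add2l.
  apply: leq_trans (free_nbrs v degG Xu) _; apply: subset_leq_card; apply/subsetP => x.
  by rewrite inE [in X in _ -> X]inE => /andP[].
- by apply: leq_trans Bb; apply: max_card.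
- move=> z _; rewrite -setDE; apply: leq_trans (free_nbrs z degG Xu).
  by apply: leq_trans bh; rewrite leq_add2l.
have kO x : x \in nbr q :\ c -> k x \notin v |: occupied A f F.
  by rewrite -ln => /kC; rewrite in_setC.
exists v, (glue (nbr q :\ c) k f).
have eA : {in A, glue (nbr q :\ c) k f =1 f} by move=> x; apply: glueEr.
split=> //.
- by move: vO; rewrite inE negb_or => /andP[].
- apply: (partial_emb_glue pA) => //.
  + by move=> x y; rewrite -!ln; apply: ki.
  + move=> a aA; rewrite in_setU1 negb_or fF // andbT.
    by apply: contraNneq vO => <-; rewrite inE imset_f.
  + by move=> x /kO; rewrite /occupied setUCA.
  + by move=> x y xN yN e; have := eNN x y xN yN; rewrite e.
  + by move=> x y xN yA e; have := eN x xN y yA; rewrite e.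
have WfA w : w \in slots f W v -> w \in A.
  by rewrite inE => /andP[wW _]; apply: (subsetP WA).
have : L <= #|[set w in slots f W v | all (fun x => edge (f w) (k x)) l]|.
  rewrite -(leq_pmul2l (m := B ^ D)) ?expn_gt0 ?B0 //.
  apply: leq_trans BL _; apply: leq_trans (gW v) _.
  have -> : #|slots f W v| = \sum_(z in f @: slots f W v) 1.
    by rewrite sum1_card card_in_imset // => x y /WfA xA /WfA yA; apply: fi.
  apply: leq_trans hk _; apply: leq_mul; first by rewrite leq_pexp2l.
  rewrite sum1_card -(card_in_imset (f := f)); last first.
    by move=> x y /setIdP[/WfA xA _] /setIdP[/WfA yA _]; apply: fi.
  apply: subset_leq_card; apply/subsetP => z.
  rewrite unfold_in => /andP[/imsetP[w wD ->] hw].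
  by apply: imset_f; apply/setIdP.
move=> h1; apply: leq_trans h1 _; apply: subset_leq_card; apply/subsetP => w.
case/setIdP=> wD hw; have wA := WfA w wD.
apply/setIdP; rewrite (eq_slots v eA nW); split=> //; apply/subsetP => a aN; rewrite inE eA //.
by rewrite glueE //; apply: (allP hw); rewrite ln.
Qed.

Definition anchors (ql : seq T) (c : T) : {set T} :=
  [set x | has (fun q => x \in nbr q :\ c) ql].

Lemma anchors_cons q ql c : anchors (q :: ql) c = (nbr q :\ c) :|: anchors ql c.
Proof. by apply/setP => x; rewrite in_setU ![x \in anchors _ _]in_set. Qed.

Lemma anchorsP ql c x :
  reflect (exists2 q, q \in ql & (x != c) && edge q x) (x \in anchors ql c).
Proof.
rewrite inE; apply: (iffP hasP) => -[q ql' h']; exists q => //; by move: h'; rewrite !inE.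
Qed.

Lemma card_anchors ql c : #|anchors ql c| <= size ql * D.
Proof.
elim: ql => [|q ql IH].
  by rewrite (_ : anchors _ _ = set0) ?cards0 //; apply/setP => x; rewrite !inE.
rewrite anchors_cons mulSn; apply: leq_trans (leq_card_setU _ _) _.
apply: leq_add IH; apply: leq_trans (degT q).
by rewrite subset_leq_card // subsetDl.
Qed.

(** The anchors belonging to different neighbours of [c] are distinct because the
    tree has no 4-cycle, and non-adjacent because their depths have the same
    parity as that of [c]. *)
Lemma reserve_specials A f F c g ql :
    partial_emb A f F -> flippable A W -> uniq ql -> {in ql, forall q, edge c q} ->
    {in anchors (enum (nbr c)) c, forall x, x \notin A /\ forall a, a \in A -> ~~ edge x a} ->
    #|A| + #|F| + size ql * D.+1 <= u ->
    B ^ D * L <= g -> (forall v : G, g <= #|slots f W v|) ->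
  exists v f', [/\ {in A, f' =1 f},
    partial_emb (A :|: anchors ql c) f' (F :|: [set v q | q in ql]),
    {in ql &, injective v} &
    {in ql, forall q, v q \notin F /\ L <= #|anchored_slots W f' v q c|}].
Proof.
move=> pA fW; elim: ql => [|q ql IH] /= uq sq hA cu BL gW.
  exists (fun _ => f r), f; split=> //.
  have -> : anchors [::] c = set0 by apply/setP => x; rewrite !inE.
  rewrite setU0; apply: partial_emb_sub pA; apply/subsetP => x.
  by rewrite inE => /orP[//|/imsetP[]].
case/andP: uq => nq uq.
have cq : edge c q by apply: sq; rewrite inE eqxx.
have sq' : {in ql, forall q, edge c q} by move=> x xq; apply: sq; rewrite inE xq orbT.
have [|v1 [f1 [ef1 pA1 v1i v1P]]] := IH uq sq' hA _ BL gW.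
  by apply: leq_trans cu; rewrite leq_add2l leq_mul2r leqnSn orbT.
set A1 := A :|: anchors ql c in pA1; set F1 := F :|: _ in pA1.
have sqN q' x : edge c q' -> x \in nbr q' :\ c -> x \in anchors (enum (nbr c)) c.
  move=> cq'; rewrite !inE => h1; apply/hasP; exists q'; last by rewrite !inE.
  by rewrite mem_enum inE.
have fW1 : flippable A1 W by apply: flippable_sub fW; apply: subsetUl.
have sF1 : #|F1| <= #|F| + size ql.
  apply: leq_trans (leq_card_setU _ _) _; rewrite leq_add2l.
  by apply: leq_trans (leq_imset_card _ _) _; apply: card_size.
have sA1 : #|A1| <= #|A| + size ql * D.
  apply: leq_trans (leq_card_setU _ _) _; rewrite leq_add2l; exact: card_anchors.
have odd_anchor q' x : edge c q' -> x \in nbr q' :\ c -> odd (d x) = odd (d c).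
  move=> cq'; rewrite !inE => /andP[_ e].
  by have := edge_odd R e; have := edge_odd R cq'; do 3 case: odd.
have [||||||w [f2 [wF ef2 pA2 Lw]]] := @reserve_special
   A1 f1 F1 q c g pA1 fW1.
- apply: leq_ltn_trans (card_occupied _ _ _) _; apply: leq_ltn_trans (leq_add sA1 sF1) _.
  apply: leq_trans cu; rewrite mulSn mulnS.
  have ar a k s a1 e : a + k + (a1 + s) < a + a1 + (e.+1 + (s + k)) by clear; lia.
  exact: ar.
- rewrite disjoint_sym; apply/pred0P => x /=; apply/negP => /andP[xq].
  rewrite inE => /orP[xA|].
    by have [] := hA x (sqN q x cq xq); rewrite xA.
  case/anchorsP => q' q'l /andP[xc e].
  have := common_nbr_unique R (x := c) (y := x) (q := q) (q' := q').
  move: xq; rewrite !inE xc /= => e1.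
  rewrite eq_sym xc cq (edge_sym x q) e1 sq' // (edge_sym x q') e => /(_ isT isT isT isT isT) qq.
  by rewrite qq q'l in nq.
- move=> x xq a; rewrite inE => /orP[aA|].
    by have [_] := hA x (sqN q x cq xq); apply.
  case/anchorsP => q' q'l /andP[ac e].
  have o1 := odd_anchor q x cq xq.
  have o2 : odd (d a) = odd (d c) by apply: (odd_anchor q' a); rewrite ?sq' // !inE ac.
  by apply/negP => /(edge_odd R); rewrite o1 o2; case: odd.
- move=> x y xq yq; apply/negP => /(edge_odd R).
  by rewrite (odd_anchor q x) // (odd_anchor q y) //; case: odd.
- exact: BL.
- move=> w; rewrite (eq_slots (A := A) w ef1) //; by case: fW.
have nql x : x \in ql -> (x == q) = false.
  by move=> xl; apply/negbTE; apply: contraNneq nq => <-.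
move: wF; rewrite inE negb_or => /andP[wF wv].
have sA12 : A \subset A1 by apply: subsetUl.
exists (fun x => if x == q then w else v1 x), f2; split.
- by move=> x xA; rewrite ef2 ?ef1 // (subsetP sA12).
- rewrite anchors_cons (setUC (nbr q :\ c)) setUA; apply: partial_emb_sub pA2.
  apply/subsetP => x; rewrite !in_setU => /orP[->|]; first by rewrite orbT.
  case/imsetP => y yl ->; have {yl} : (y == q) || (y \in ql) by [].
  case: (eqVneq y q) => [_ _|ny /= yl]; first by rewrite inE eqxx.
  by rewrite imset_f ?orbT.
- have wne y : y \in ql -> w <> v1 y.
    by move=> yl e; move: wv; rewrite e imset_f.
  move=> x y; rewrite !inE; case: (eqVneq x q) => [->|nx]; case: (eqVneq y q) => [->|ny] //= xl yl.
  + by move/(wne y yl).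
  + by move/esym/(wne x xl).
  + exact: v1i.
- move=> x; rewrite inE => /orP[/eqP->|xl]; first by rewrite /anchored_slots eqxx.
  have [h1 h2] := v1P x xl; split; first by rewrite (nql x xl).
  apply: leq_trans h2 _; apply: subset_leq_card; apply: anchored_slots_sub fW1 _ _ => //.
    apply/subsetP => y; rewrite !inE => h3; apply/orP; right; apply/hasP.
    by exists x; rewrite // !inE.
  by rewrite (nql x xl).
Qed.

(** The centre [c] is taken at distance 5 from the treated part.  All the
    anchors of the gap are embedded without any contact with that part, and the
    anchor nearest to the root is then linked to it. *)
Lemma gap_step A f C v g :
    gapped A f C v -> flippable A W -> downclosed R (touched A C) ->
    #|touched A C| + (D + 3) ^ 2 <= u ->
    B ^ D * L <= g -> (forall x : G, g <= #|slots f W x|) ->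
  exists A' f' C' v', [/\ gapped A' f' C' v', A \subset A', {in A, f' =1 f} &
    [/\ #|C'| = #|C|.+1, downclosed R (touched A' C') &
        #|touched A' C'| <= #|touched A C| + (D + 3) ^ 2]].
Proof.
move=> [pA vi dAC dCS gapP] fW dE cu BL gW.
set E := touched A C in dE cu *; set S := nbrs C in pA vi dCS.
have [|c cE cE'] := far_vertex (k := 4) degT dE.
  apply: leq_ltn_trans T_large; apply: leq_mul; first by apply: leq_trans cu; apply: leq_addr.
  by rewrite leq_pexp2l // addn1.
have sAE : A \subset E by rewrite /E /touched -setUA subsetUl.
have sCE : C \subset E by rewrite /E /touched setUAC subsetUr.
have sSE : S \subset E by rewrite /E /touched subsetUr.
have nAE x : x \notin E -> x \notin A by apply: contra; apply: (subsetP sAE).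
set z1 := iter 4 p c in cE'; set z2 := iter 3 p c; set a0 := iter 2 p c; set q0 := p c.
have nE j : j <= 4 -> iter j p c \notin E.
  by move=> j3; apply: downclosed_iter dE j3 cE'.
have dj j : j <= 4 -> d (iter j p c) = (d (iter j.+1 p c)).+1.
  move=> j3; rewrite iterS; apply: dep_par.
  exact: downclosed_notin_root dE (nE j j3).
have d0 : d c = (d q0).+1 by apply: (dj 0).
have d1 : d q0 = (d a0).+1 by apply: (dj 1).
have d2 : d a0 = (d z2).+1 by apply: (dj 2).
have d3 : d z2 = (d z1).+1 by apply: (dj 3).
have c_nE : c \notin E by apply: (nE 0).
have q0_nE : q0 \notin E by apply: (nE 1).
have a0_nE : a0 \notin E by apply: (nE 2).
have z2_nE : z2 \notin E by apply: (nE 3).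
have cr := downclosed_notin_root dE c_nE.
have q0r := downclosed_notin_root dE q0_nE.
have ecq0 : edge c q0 by apply: edge_parent.
have eq0a : edge q0 a0 by apply: edge_parent.
have childc q : edge c q -> q != q0 -> p q = c.
  by move=> e nq; case: (nbr_par e nq).
have a0c : a0 != c by apply/eqP => e; have := congr1 d e; clear -d0 d1; lia.
have par_nE x : p x \notin E -> x \notin E by apply: contra; case: dE => _; apply.
(* Apart from [a0], each anchor hangs below a neighbour of [c]. *)
have anch_par x : x \in anchors (enum (nbr c)) c ->
    (x == a0) || (edge c (p x) && (d x == (d (p x)).+1)).
  case/anchorsP => q; rewrite mem_enum inE => ecq /andP[xc eqx].
  case: (eqVneq x a0) => //= na.
  have nx : x != p q.
    apply/eqP => e; case: (eqVneq q q0) => nq; first by move: na; rewrite e nq eqxx.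
    by rewrite e (childc q ecq nq) eqxx in xc.
  have [xr px] := nbr_par eqx nx.
  by rewrite px ecq (dep_par xr) px eqxx.
have anch_nE x : x \in anchors (enum (nbr c)) c -> p x \notin E.
  case/anch_par/orP => [/eqP->//|/andP[ecx _]].
  case: (eqVneq (p x) q0) => [-> //|nq].
  by apply: par_nE; rewrite (childc _ ecx nq).
have nbrc_nE q : edge c q -> q \notin E.
  move=> ecq; case: (eqVneq q q0) => [-> //|nq].
  by apply: par_nE; rewrite (childc _ ecq nq).
have S_nbrc q : q \in S -> ~~ edge c q.
  by move=> qS; apply/negP => /nbrc_nE; rewrite (subsetP sSE).
have cnbr : #|nbr c| <= D := degT c.
have szl : size (enum (nbr c)) = #|nbr c| by rewrite -cardE.
have cFA : #|A| + #|v @: S| <= #|E|.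
  apply: (@leq_trans (#|A| + #|S|)); first by rewrite leq_add2l leq_imset_card.
  have dAS : A :&: S = set0.
    apply/setP => x; rewrite !inE; apply/negP => /andP[xA].
    by case/in_nbrs => c' cC e; have [] := gapP c' cC x e; rewrite xA.
  have := cardsU A S; rewrite dAS cards0 subn0 => <-.
  by apply: subset_leq_card; rewrite subUset sAE sSE.
have usz : #|A| + #|v @: S| + D * D.+1 + 4 <= u.
  have ar : D * D.+1 + 4 <= (D + 3) ^ 2 by rewrite -mulnn; clear; nia.
  by apply: leq_trans cu; rewrite -addnA leq_add.
have [|||||v1 [f1 [ef1 pA1 v1i v1P]]] := @reserve_specials A f _ c g (enum (nbr c)) pA fW (enum_uniq _).
- by move=> q; rewrite mem_enum inE.
- move=> x xa; split; first by apply: nAE; apply: par_nE; apply: anch_nE.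
  move=> a aA; apply/negP => e.
  have xE : x \notin E by apply: par_nE; apply: anch_nE.
  have aE := subsetP sAE a aA.
  by have := anch_nE x xa; rewrite -(downclosed_cross dE xE aE e) aE.
- apply: leq_trans usz; apply: leq_trans (leq_addr 4 _).
  by rewrite leq_add2l szl leq_mul2r cnbr orbT.
- exact: BL.
- by [].
set N := anchors _ c in anch_par anch_nE pA1.
have c_anch : #|N| <= D * D.
  by apply: leq_trans (card_anchors _ _) _; rewrite szl leq_mul2r cnbr orbT.
have c_v1 : #|[set v1 q | q in enum (nbr c)]| <= D.
  apply: leq_trans (leq_imset_card _ _) _; apply: leq_trans cnbr.
  by apply: subset_leq_card; apply/subsetP => x; rewrite mem_enum.
have a0N : a0 \in N.
  by apply/anchorsP; exists q0; rewrite ?mem_enum ?inE // a0c.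
have depN x : x \in N -> d x = d a0 \/ d x = d c \/ d x = d c + 2.
  case/anch_par/orP => [/eqP->|/andP[/(edge_dep R) e /eqP]]; first by left.
  by move: e; clear -d0 d1; lia.
(* A vertex with an untreated neighbour cannot belong to a gap. *)
have yA : p z1 \in A.
  move: (cE); rewrite iterS -/z1 => yE; have ez : edge (p z1) z1.
    by apply: edge_parent_l; apply: downclosed_notin_root dE cE'.
  move: yE; rewrite /E /touched !inE => /orP[/orP[//|yC]|].
    by case/negP: cE'; apply: (subsetP sSE); apply/in_nbrs; exists (p z1).
  case/in_nbrs => c' cC e; have [_ sA _] := gapP c' cC _ e.
  case/negP: cE'; case: (eqVneq z1 c') => [->|nz]; first exact: (subsetP sCE).
  by apply: (subsetP sAE); apply: (subsetP sA); rewrite !inE nz.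
have [||||||||f2 ef2 pf2] := partial_emb_link (y := p z1) (c := a0) (z1 := z1) (z2 := z2) Gm pA1.
- move=> x; apply: leq_trans mh _.
  have cO : #|occupied (A :|: N) f1 (v @: S :|: [set v1 q | q in enum (nbr c)])| <= u.
    apply: leq_trans (card_occupied _ _ _) _; apply: leq_trans usz.
    apply: leq_trans (leq_addr 4 _).
    apply: leq_trans (leq_add (leq_card_setU _ _) (leq_card_setU _ _)) _.
    rewrite addnACA leq_add2l mulnSr; exact: leq_add.
  exact: free_nbrs degG cO.
- by rewrite inE yA.
- by rewrite inE a0N orbT.
- rewrite inE (negbTE (nAE _ cE')) /=; apply/negP => /depN.
  by clear -d0 d1 d2 d3; lia.
- rewrite inE (negbTE (nAE _ z2_nE)) /=; apply/negP => /depN.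
  by clear -d0 d1 d2 d3; lia.
- by apply/eqP => e; have := congr1 d e; clear -d3; lia.
- move=> a; rewrite inE => /orP[aA e|/depN aN /(edge_dep R)].
    exact: downclosed_cross dE cE' (subsetP sAE _ aA) e.
  by move: aN; clear -d0 d1 d2 d3; lia.
- move=> a; rewrite inE => /orP[aA e|aN e].
    have := downclosed_cross dE z2_nE (subsetP sAE _ aA) e => ea.
    by move: cE'; rewrite /z1 iterS -/z2 -ea (subsetP sAE).
  case/anch_par/orP: (aN) => [/eqP //|/andP[ec /eqP da]]; exfalso.
  case: (edge_dep R ec); case: (edge_dep R e) => h1 h2; move: h1 h2 da;
    case: (depN a aN); clear -d0 d1 d2 d3; lia.
have z1_nE := cE'.
have dEp x : x \in E -> p x \in E by case: dE => _; apply.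
pose A' := A :|: N :|: [set z1; z2]; pose C' := c |: C.
pose v' q := if q \in nbr c then v1 q else v q.
have v'old q : q \in S -> v' q = v q.
  by move=> qS; rewrite /v' inE (negbTE (S_nbrc q qS)).
have v'new q : edge c q -> v' q = v1 q by move=> e; rewrite /v' inE e.
have nbrsC' : nbrs C' = nbr c :|: S by rewrite /C' nbrsU /nbrs big_set1.
have N_nE x : x \in N -> x \notin E by move=> xN; apply: par_nE; apply: anch_nE.
have inA' x : (x \in A') = [|| x \in A, x \in N, x == z1 | x == z2].
  by rewrite !in_setU !in_set1 -!orbA.
have new_nE x : x \in A' -> x \in A \/ x \notin E.
  rewrite inA' => /or4P[xA|xN|/eqP->|/eqP->]; [by left|by right; apply: N_nE|by right|by right].
have nbrc_nA' q : edge c q -> q \notin A'.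
  move=> e; have dq := edge_dep R e; have oq := edge_odd R e.
  rewrite inA' (negbTE (nAE _ (nbrc_nE q e))) /=; apply/norP; split.
    apply/negP => /anchorsP[q']; rewrite mem_enum in_nbr => e1 /andP[_ e2].
    have := edge_odd R e1; have := edge_odd R e2; rewrite oq; by do 2 case: odd.
  by apply/negP => /orP[] /eqP eq; move: dq; rewrite eq; clear -d0 d1 d2 d3; lia.
have c_nA' : c \notin A'.
  rewrite inA' (negbTE (nAE _ c_nE)) /=; apply/norP; split.
    by apply/negP => /anchorsP[q' _]; rewrite eqxx.
  by apply/negP => /orP[] /eqP eq; have := congr1 d eq; clear -d0 d1 d2 d3; lia.
have old_nA' x : x \in E -> x \notin A -> x \notin A'.
  by move=> xE xA; apply/negP => /new_nE[]; [rewrite (negbTE xA)|rewrite xE].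
have e2A : {in A, f2 =1 f}.
  by move=> x xA; rewrite ef2 ?ef1 // inE xA.
have sAA' : A \subset A' by rewrite /A' -setUA subsetUl.
have sNA' x : x \in N -> x \in A' by move=> xN; rewrite inA' xN orbT.
have fW1 : flippable (A :|: N) W by apply: flippable_sub fW; apply: subsetUl.
have tE : touched A' C' = E :|: ((N :|: [set z1; z2]) :|: (c |: nbr c)).
  rewrite /touched nbrsC' /A' /C' /E /touched -/S.
  by apply/setP => x; rewrite !in_setU; do !case: (_ \in _); rewrite ?orbT.
exists A', f2, C', v'; split.
- split.
  + apply: partial_emb_sub pf2; apply/subsetP => x /imsetP[q]; rewrite nbrsC' in_setU in_nbr.
    case/orP=> [ecq|qS] ->.
      rewrite v'new // in_setU; apply/orP; right; apply: imset_f.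
      by rewrite mem_enum in_nbr.
    by rewrite v'old // in_setU imset_f.
  + move=> x y; rewrite nbrsC' !in_setU !in_nbr => /orP[ex|xS] /orP[ey|yS].
    * by rewrite !v'new //; apply: v1i; rewrite mem_enum in_nbr.
    * rewrite v'new // v'old // => e; have [] := v1P x _; first by rewrite mem_enum in_nbr.
      by rewrite e imset_f.
    * rewrite (v'new y) // (v'old x) // => e; have [] := v1P y _; first by rewrite mem_enum in_nbr.
      by rewrite -e imset_f.
    * by rewrite !v'old //; apply: vi.
  + rewrite disjoint_sym; apply/pred0P => x /=; apply/negP => /andP[].
    rewrite in_setU1 => /orP[/eqP->|xC]; first by rewrite (negbTE c_nA').
    by rewrite (negbTE (old_nA' x (subsetP sCE x xC) _)) // (disjointFl dAC xC).
  + apply/pred0P => x /=; apply/negP => /andP[].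
    rewrite nbrsC' in_setU in_nbr in_setU1 => /orP[/eqP->|xC] /orP[].
    * by rewrite edge_irrefl.
    * by move=> cS; case/negP: c_nE; apply: (subsetP sSE).
    * by move/nbrc_nE; rewrite (subsetP sCE).
    * by rewrite (disjointFr dCS xC).
  + move=> c' /setU1P[->|cC] q e.
      have qe : q \in enum (nbr c) by rewrite mem_enum in_nbr.
      have sN : nbr q :\ c \subset N.
        by apply/subsetP => x; rewrite !inE => xq; apply/hasP; exists q; rewrite // !inE.
      split; first exact: nbrc_nA'.
        by apply/subsetP => x /(subsetP sN)/sNA'.
      have [_ Lq] := v1P q qe; apply: leq_trans Lq _; apply: subset_leq_card.
      apply: anchored_slots_sub ef2 fW1 _ _; last by rewrite v'new.
      by apply: subset_trans sN _; apply: subsetUr.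
    have [qA sA Lq] := gapP c' cC q e.
    have qS : q \in S by apply/in_nbrs; exists c'.
    split; first by apply: old_nA'; rewrite ?(subsetP sSE).
      exact: subset_trans sA sAA'.
    apply: leq_trans Lq _; apply: subset_leq_card.
    by apply: anchored_slots_sub e2A fW sA _; rewrite v'old.
- exact: sAA'.
- exact: e2A.
- split.
  + by rewrite cardsU1 (contra (subsetP sCE c) c_nE).
  + rewrite tE; split; first by rewrite in_setU; case: dE => ->.
    move=> x; rewrite in_setU => /orP[xE|]; first by rewrite in_setU dEp.
    rewrite [in X in X -> _]in_setU => /orP[|].
      rewrite in_setU => /orP[/anch_par/orP[/eqP->|/andP[e _]]|/set2P[->|->]].
      * by rewrite -/z2 !inE eqxx !orbT.
      * by rewrite !in_setU in_nbr e !orbT.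
      * by rewrite in_setU (_ : p z1 \in E).
      * by rewrite -/z1 !inE eqxx !orbT.
    rewrite in_setU1 in_nbr => /orP[/eqP->|e].
      by rewrite -/q0 !in_setU in_nbr ecq0 !orbT.
    case: (eqVneq x q0) => [->|nq]; first by rewrite -/a0 !in_setU a0N !orbT.
    by rewrite (childc x e nq) !in_setU !in_set1 eqxx !orbT.
  + rewrite tE; apply: leq_trans (leq_card_setU _ _) _; rewrite leq_add2l.
    apply: leq_trans (leq_card_setU _ _) _.
    apply: leq_trans (leq_add (leq_card_setU _ _) (leqnn _)) _.
    rewrite cards2 cardsU1 in_nbr edge_irrefl /=.
    by case: (z1 != z2); move: c_anch cnbr; rewrite -mulnn; clear; nia.
Qed.

Lemma gaps_exist A f g s :
    partial_emb A f set0 -> flippable A W -> downclosed R A ->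
    B ^ D * L <= g -> #|A| + s * (D + 3) ^ 2 <= u -> (forall x : G, g <= #|slots f W x|) ->
  exists A' f' C v, [/\ gapped A' f' C v, A \subset A', {in A, f' =1 f},
    #|C| = s &
    downclosed R (touched A' C) /\ #|touched A' C| <= #|A| + s * (D + 3) ^ 2].
Proof.
move=> pA fW dA BL + Wg; elim: s => [|s IH] cu.
  exists A, f, set0, f; have n0 : nbrs (set0 : {set T}) = set0 by rewrite /nbrs big_set0.
  have t0 : touched A set0 = A by rewrite /touched n0 !setU0.
  split; rewrite ?t0 ?cards0 ?mul0n ?addn0 //.
  split; rewrite ?n0 ?imset0 //.
  - by move=> x y; rewrite inE.
  - by rewrite disjoint_sym disjoints_subset sub0set.
  - by rewrite disjoints_subset sub0set.
  - by move=> c; rewrite inE.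
have [|A1 [f1 [C1 [v1 [g1 sA1 e1 c1 [d1 t1]]]]]] := IH.
  by apply: leq_trans cu; rewrite leq_add2l leq_mul2r leqnSn orbT.
have fW1 : flippable A1 W by apply: flippable_sub fW.
have [||A2 [f2 [C2 [v2 [g2 sA2 e2 [c2 d2 t2]]]]]] :=
    gap_step g1 fW1 d1 _ BL.
- by apply: leq_trans cu; rewrite mulSnr addnA leq_add2r.
- by move=> x; rewrite (eq_slots (A := A) x e1) //; case: fW.
exists A2, f2, C2, v2; split=> //.
- exact: subset_trans sA1 sA2.
- by move=> x xA; rewrite e2 ?e1 // (subsetP sA1).
- by rewrite c2 c1.
- by split=> //; apply: leq_trans t2 _; rewrite mulSnr addnA leq_add2r.
Qed.

End Gaps.

(** * Embedding the tree outside the gaps *)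

Section Completion.

Variables (G T : sgraph) (R : rooting T) (m D u h L : nat).
Local Notation p := (par R).
Hypothesis Gm : joined G m.
Hypothesis m0 : 0 < m.
Hypothesis degT : forall x : T, #|nbr x| <= D.
Hypothesis degG : forall x : G, h + u <= #|nbr x|.
Hypothesis mDh : 2 * m * D <= h.
Hypothesis cardGT : #|G| = #|T|.
Variables (W C : {set T}) (v : T -> G).
Hypothesis C_large : 2 * m * (D + 1) <= #|C|.
Implicit Types (A : {set T}) (f : T -> G) (F : {set G}).

Lemma card_touched A f : gapped L W A f C v ->
  #|touched A C| = #|occupied A f (v @: nbrs C)| + #|C|.
Proof.
case=> pA vi dAC dCS gP; rewrite (card_occupiedE pA) (card_in_imset vi) /touched.
rewrite cardsU (_ : (A :|: C) :&: nbrs C = set0) ?cards0 ?subn0.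
  rewrite cardsU (_ : A :&: C = set0) ?cards0 ?subn0 1?addnAC //.
  by apply/eqP; rewrite setI_eq0.
apply/setP => x; rewrite !in_setI in_setU inE; apply/negP => /andP[/orP[xA|xC]].
  by case/in_nbrs => c cC e; have [] := gP c cC x e; rewrite xA.
by rewrite (disjointFr dCS xC).
Qed.

(** The demand at an embedded vertex bounds the number of its untreated
    neighbours.  Reserved vertices keep the full demand [D], like free ones. *)
Definition extending A f dem :=
  [/\ gapped L W A f C v, flippable A W, downclosed R (touched A C),
      extendable m (occupied A f (v @: nbrs C)) dem &
      [/\ forall z, dem z <= D, {in A, forall a, #|nbr a :\: touched A C| <= dem (f a)} &
          forall z, z \notin f @: A -> dem z = D]].

Lemma extending_step A f dem t :
    extending A f dem -> t \notin touched A C -> p t \in touched A C ->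
  exists f' dem', extending (A :|: [set t]) f' dem' /\ {in A, f' =1 f}.
Proof.
move=> [gA fW dE ext [demD demA demF]] tE ptE.
have cT := card_touched gA; case: (gA) => pA vi dAC dCS gP.
set E := touched A C in tE ptE dE cT demA.
have sAE : A \subset E by rewrite /E /touched -setUA subsetUl.
have sCE : C \subset E by rewrite /E /touched setUAC subsetUr.
have sSE : nbrs C \subset E by rewrite /E /touched subsetUr.
have tA : t \notin A by apply: contra tE; apply: (subsetP sAE).
have tr := downclosed_notin_root dE tE.
(* All the neighbours of gap vertices are treated, so [p t] is not in a gap. *)
have ptA : p t \in A.
  move: ptE; rewrite /E /touched !inE => /orP[/orP[//|yC]|].
    case/negP: tE; apply: (subsetP sSE); apply/in_nbrs; exists (p t) => //.
    exact: edge_parent_l.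
  case/in_nbrs => c' cC e; have [_ sA _] := gP c' cC _ e.
  case/negP: tE; case: (eqVneq t c') => [->|nz]; first exact: (subsetP sCE).
  by apply: (subsetP sAE); apply: (subsetP sA); rewrite !inE nz edge_parent_l.
(* As [t] is still to be placed, the free vertices outnumber the centres. *)
have big : 2 * m * (D + 1) < #|~: occupied A f (v @: nbrs C)|.
  have lt_E : #|E| < #|T|.
    by rewrite -cardsT proper_card // properE subsetT /=; apply/negP => /subsetP/(_ t);
       rewrite inE (negbTE tE) => /(_ isT).
  have := cardsC (occupied A f (v @: nbrs C)); rewrite cardGT; move: lt_E C_large; rewrite cT; clear; lia.
have dem0 : 0 < dem (f (p t)).
  apply: leq_trans (demA _ ptA); apply/card_gt0P; exists t.
  by rewrite inE tE inE edge_parent_l.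
have [y yN ext'] := extendable_step Gm m0 demD ext big dem0.
move: yN; rewrite inE in_nbr => /andP[yO ey].
have dAt : [disjoint A & [set t]] by rewrite disjoint_sym disjoints1.
set f' := glue [set t] (fun _ => y) f.
have f't : f' t = y by rewrite /f' glueE // inE.
have f'A : {in A, f' =1 f} by move=> a aA; rewrite /f' (glueEr _ _ dAt).
have touched' : touched (A :|: [set t]) C = t |: E.
  by rewrite /E /touched (setUC A) -!setUA.
have f'im : f' @: (A :|: [set t]) = y |: f @: A.
  rewrite imsetU imset_set1 f't setUC; congr (_ :|: _); exact: eq_in_imset.
exists f', (fun z => if z == f (p t) then (dem z).-1 else dem z); split=> //.
have tnC : t \notin C by apply: contra tE; apply: (subsetP sCE).
split.
- split=> //.
  + apply: (partial_emb_glue pA) => //.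
    * by move=> x x' /set1P-> /set1P->.
    * by case: pA.
    * by move=> x x' /set1P-> /set1P->; rewrite edge_irrefl.
    * move=> x a /set1P-> aA e; rewrite (downclosed_cross dE tE (subsetP sAE _ aA) e).
      by rewrite edge_sym.
  + rewrite disjoint_sym; apply/pred0P => x /=; apply/negP => /andP[xC].
    by rewrite !inE => /orP[xA|/eqP e]; [rewrite (disjointFr dAC xA) in xC|rewrite -e xC in tnC].
  + move=> c cC q e; have [qA sA Lq] := gP c cC q e; split.
    * rewrite !inE negb_or qA /=; apply: contraNneq tE => <-.
      by apply: (subsetP sSE); apply/in_nbrs; exists c.
    * exact: subset_trans sA (subsetUl _ _).
    * apply: leq_trans Lq _; apply: subset_leq_card; exact: anchored_slots_sub f'A fW sA _.
- by apply: flippable_sub fW; apply: subsetUl.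
- rewrite touched'; case: dE => rE dE; split; first by rewrite in_setU1 rE orbT.
  by move=> x; rewrite !in_setU1 => /orP[/eqP->|/dE->]; rewrite ?ptE orbT.
- by rewrite {1}/occupied f'im -setUA.
- split.
  + by move=> z; case: ifP => _ //; apply: leq_trans (leq_pred _) _.
  + move=> a; rewrite touched' in_setU in_set1 => /orP[aA|/eqP->]; last first.
      rewrite f't; case: eqP => [e|_]; first by move: ey; rewrite -e edge_irrefl.
      rewrite demF; last by apply: contra yO => h1; rewrite inE h1.
      by apply: leq_trans (degT t); rewrite subset_leq_card // subsetDl.
    rewrite f'A //; case: eqP => [e|_]; last first.
      by apply: leq_trans (demA a aA); rewrite subset_leq_card // setDS // subsetUr.
    have ea : a = p t by case: pA => fi _ _; apply: fi.
    have := demA a aA; rewrite (cardsD1 t) [t \in _]in_setD tE in_nbr {1}ea edge_parent_l //=.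
    rewrite setDDl setUC; clear; lia.
  + move=> z; rewrite f'im in_setU1 negb_or => /andP[_ zA].
    by rewrite ifN ?demF //; apply: contraNneq zA => ->; rewrite imset_f.
Qed.

Lemma complete A f :
    gapped L W A f C v -> flippable A W -> downclosed R (touched A C) ->
    #|touched A C| <= u ->
  exists f', [/\ gapped L W (~: (C :|: nbrs C)) f' C v, flippable (~: (C :|: nbrs C)) W &
     {in A, f' =1 f}].
Proof.
move=> gA fW dE cu.
have ext : extending A f (fun _ => D).
  split=> //.
    move=> U cU; rewrite sum_nat_const; case: (set_0Vmem U) => [->|[x xU]].
      by rewrite cards0.
    apply: (@leq_trans h); first by apply: leq_trans mDh; rewrite leq_mul2r cU orbT.
    apply: (@leq_trans #|nbr x :\: occupied A f (v @: nbrs C)|); last first.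
      by rewrite subset_leq_card // setSD //; apply: bigcup_sup.
    apply: free_nbrs degG _; move: cu; rewrite (card_touched gA); clear; lia.
  split=> // a _; apply: leq_trans (degT a); by rewrite subset_leq_card // subsetDl.
move: (fun _ => D) ext => dem ext; clear gA fW dE cu.
have [n] := ubnP #|~: touched A C|; elim: n A f dem ext => // n IH A f dem ext cn.
case: (boolP [exists x, x \notin touched A C]) => [/existsP[x xE]|].
  have dE : downclosed R (touched A C) by case: ext.
  have [t tE ptE] := downclosed_boundary dE xE.
  have [f1 [dem1 [ext1 e1]]] := extending_step ext tE ptE.
  have [|f2 [gf2 fl2 e2]] := IH _ _ _ ext1.
    rewrite -ltnS; apply: leq_trans cn; rewrite ltnS.
    have -> : touched (A :|: [set t]) C = t |: touched A C by rewrite /touched (setUC A) -!setUA.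
    have := cardsC (touched A C); have := cardsC (t |: touched A C).
    rewrite cardsU1 tE; clear; lia.
  exists f2; split=> // a aA; rewrite e2 ?e1 // inE aA //.
move=> /existsPn h1; case: ext => gA fW _ _ _.
have hE x : x \in touched A C by have := h1 x; rewrite negbK.
have eA : ~: (C :|: nbrs C) = A.
  apply/setP => x; have := hE x; rewrite /touched !in_setU in_setC in_setU.
  case: gA => _ _ dAC _ gP; case: (boolP (x \in A)) => xA /= => [_|->//].
  rewrite (disjointFr dAC xA) /=; apply/negP => /in_nbrs[c cC e].
  by have [] := gP c cC x e; rewrite xA.
by exists f; rewrite eA.
Qed.

End Completion.

(** * Filling the gaps *)

Section Fill.

Variables (G T : sgraph) (m D L g : nat).
Hypothesis Gm : joined G m.
Hypothesis m0 : 0 < m.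
Hypothesis degT : forall x : T, #|nbr x| <= D.
Hypothesis cardGT : #|G| = #|T|.
Variables (W C : {set T}) (v f : T -> G).
Local Notation A := (~: (C :|: nbrs C)).
Hypothesis gA : gapped L W A f C v.
Hypothesis fW : flippable A W.
Hypothesis L_large : #|C| * D.+1 + m * (D + 2) <= L.
Hypothesis g_large : #|C| * D.+1 + D * m < g.
Hypothesis Wg : forall x : G, g <= #|slots f W x|.

Definition cells (cl : seq T) : {set T} := [set x | has (fun c => x \in c |: nbr c) cl].

Lemma cellsP cl x : reflect (exists2 c, c \in cl & x \in c |: nbr c) (x \in cells cl).
Proof. by rewrite inE; apply: hasP. Qed.

Lemma cells_cons c cl : cells (c :: cl) = (c |: nbr c) :|: cells cl.
Proof. by apply/setP => x; rewrite in_setU ![x \in cells _]in_set. Qed.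

Lemma card_cells cl : #|cells cl| <= size cl * D.+1.
Proof.
elim: cl => [|c cl IH].
  by rewrite (_ : cells _ = set0) ?cards0 //; apply/setP => x; rewrite !inE.
rewrite cells_cons mulSn; apply: leq_trans (leq_card_setU _ _) _.
by apply: leq_add IH; rewrite cardsU1 inE edge_irrefl add1n ltnS.
Qed.

(** One gap: [x] is the leftover vertex for its centre [c], and [o] selects the
    slots whose images go to the gap, outside the set [U] of slots used before.
    By [few_poor] some slot of [x] has an image adjacent to more than [D]
    anchored slots of each neighbour of [c], and then distinct ones can be
    chosen greedily. *)
Lemma fill_cell (U : {set T}) c x :
    c \in C -> #|U| + m * (D + 2) <= L -> #|U| + D * m < g ->
  exists o : T -> T, [/\ {in c |: nbr c &, injective o},
    o c \in slots f W x,
    {in nbr c, forall q, o q \in anchored_slots W f v q c /\ edge (f (o c)) (f (o q))} &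
    {in c |: nbr c, forall y, o y \notin U}].
Proof.
move=> cC UL Ug; case: (gA) => pA vi _ _ gP; case: (pA) => fi _ fe.
case: (fW) => WA nW iW.
have fiW : {in W &, injective f}.
  by move=> y z /(subsetP WA) yA /(subsetP WA) zA; apply: fi.
have card_im (S : {set T}) : S \subset W -> #|f @: S| = #|S|.
  move=> SW; apply: card_in_imset => y z yS zS; apply: fiW; exact: (subsetP SW).
have card_sub (S : {set T}) k : #|U| + k <= #|S| -> k <= #|S :\: U|.
  have := cardsID U S; have := subset_leq_card (subsetIr S U); clear; lia.
pose S q := anchored_slots W f v q c :\: U.
have SW q : S q \subset W.
  by apply/subsetP => y; rewrite !in_setD => /andP[_ /setIdP[/setIdP[]]].
pose Y := slots f W x :\: U.
have YW : Y \subset W by apply/subsetP => y; rewrite !in_setD => /andP[_ /setIdP[]].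
have cY : D * m < #|Y| by apply: card_sub; rewrite addnS; apply: leq_trans (Wg x).
have cS q : q \in nbr c -> m * (D + 2) <= #|S q|.
  by rewrite inE => e; apply: card_sub; have [_ _] := gP c cC q e; apply: leq_trans.
pose bad q := [set z in f @: Y | #|nbr z :&: f @: S q| <= D].
have c_bad : #|\bigcup_(q in nbr c) bad q| <= D * m.
  apply: (@leq_trans (#|nbr c| * m)); last by rewrite leq_mul2r degT orbT.
  apply: leq_card_bigcup => q qc; apply: ltnW; apply: few_poor => //.
  by rewrite card_im // cS.
have [z zY zb] : exists2 z, z \in f @: Y & z \notin \bigcup_(q in nbr c) bad q.
  apply/exists_inP; rewrite -[X in is_true X]negbK negb_exists_in; apply/negP => /forall_inP h.
  have : #|f @: Y| <= #|\bigcup_(q in nbr c) bad q|.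
    by apply: subset_leq_card; apply/subsetP => z /h; rewrite negbK.
  by rewrite card_im // leqNgt (leq_ltn_trans c_bad).
case/imsetP: zY => y yY zy.
have rich q : q \in nbr c -> D < #|nbr z :&: f @: S q|.
  move=> qc; rewrite ltnNge; apply: contra zb => h; apply/bigcupP; exists q => //.
  by rewrite inE zy imset_f // -zy.
pose N q := [set w in S q | edge z (f w)].
have cN q : q \in nbr c -> D < #|N q|.
  move=> qc; apply: leq_trans (rich q qc) _.
  apply: leq_trans (leq_imset_card f (mem (N q))); apply: subset_leq_card.
  apply/subsetP => z'; rewrite in_setI in_nbr => /andP[e /imsetP[w wS ew]].
  by rewrite ew; apply: imset_f; apply/setIdP; rewrite -ew.
have [|s si sN] := @greedy_sdr _ _ c (enum (nbr c)) N (enum_uniq _).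
  by move=> q; rewrite mem_enum => qc; rewrite -cardE; apply: leq_trans (ltnW (cN q qc)).
have ncc q : edge c q -> (q == c) = false.
  by move=> e; apply/negbTE; apply: contraTneq e => ->; rewrite edge_irrefl.
have sq q : edge c q -> s q \in N q by move=> e; apply: sN; rewrite mem_enum inE.
have es q : edge c q -> edge z (f (s q)) by move=> e; case/setIdP: (sq q e).
exists (fun q => if q == c then y else s q); split.
- have sy q : edge c q -> y <> s q by move=> e ey; have := es q e; rewrite zy ey edge_irrefl.
  move=> q q'; rewrite !in_setU1 !in_nbr => /orP[/eqP->|e] /orP[/eqP->|e'] //;
    rewrite ?eqxx ?(ncc q) ?(ncc q') //.
  + by move/(sy _ e').
  + by move/esym/(sy _ e).
  + by apply: si; rewrite mem_enum in_nbr.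
- by rewrite eqxx; move: yY; rewrite in_setD => /andP[].
- move=> q; rewrite in_nbr => e; rewrite eqxx ncc // -zy es //; split=> //.
  by case/setIdP: (sq q e); rewrite in_setD => /andP[].
- move=> q /setU1P[->|]; first by rewrite eqxx; move: yY; rewrite in_setD => /andP[].
  by rewrite in_nbr => e; rewrite ncc //; case/setIdP: (sq q e); rewrite in_setD => /andP[].
Qed.

Lemma fill_cells (eta : T -> G) cl :
    uniq cl -> {subset cl <= C} ->
  exists o : T -> T, [/\ {in cells cl &, injective o},
    {in cl, forall c, o c \in slots f W (eta c)} &
    {in cl, forall c q, edge c q ->
       o q \in anchored_slots W f v q c /\ edge (f (o c)) (f (o q))}].
Proof.
case: (gA) => pA vi _ dCS gP.
elim: cl => [|c cl IH] /=.
  by exists id; split=> // x y; rewrite !inE.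
case/andP=> ncl ul sC.
have cC : c \in C by apply: sC; rewrite inE eqxx.
have sC' : {subset cl <= C} by move=> x xl; apply: sC; rewrite inE xl orbT.
have [o1 [o1i o1d o1s]] := IH ul sC'.
have cU : #|o1 @: cells cl| <= #|C| * D.+1.
  apply: leq_trans (leq_imset_card _ _) _; apply: leq_trans (card_cells _) _.
  rewrite leq_mul2r; apply/orP; right; rewrite -(card_uniqP ul).
  by apply: subset_leq_card; apply/subsetP => x /sC'.
have [||o2 [o2i o2d o2s o2U]] := @fill_cell (o1 @: cells cl) c (eta c) cC.
- by apply: leq_trans L_large; rewrite leq_add2r.
- by apply: leq_ltn_trans g_large; rewrite leq_add2r.
have dis x : x \in cells cl -> x \notin c |: nbr c.
  case/cellsP => c' c'l; have c'C := sC' c' c'l.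
  have nc : c' != c by apply: contraNneq ncl => <-.
  move=> xc; apply/negP => xc'; move: xc xc'; rewrite !in_setU1 !in_nbr.
  case/orP=> [/eqP->|e] /orP[/eqP e1|e2].
  - by rewrite e1 eqxx in nc.
  - have := disjointFr dCS c'C; move/negP; apply; apply/in_nbrs; by exists c.
  - have := disjointFr dCS cC; move/negP; apply; apply/in_nbrs; by exists c'; rewrite -?e1.
  - have [_ /subsetP/(_ c) + _] := gP c' c'C x e.
    rewrite !inE eq_sym nc edge_sym e2 /= => /(_ isT).
    by rewrite cC.
have o1E x : x \in cells cl -> (if x \in c |: nbr c then o2 x else o1 x) = o1 x.
  by move/dis/negbTE->.
have o2E x : x \in c |: nbr c -> (if x \in c |: nbr c then o2 x else o1 x) = o2 x.
  by move=> ->.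
exists (fun x => if x \in c |: nbr c then o2 x else o1 x); split.
- move=> x y; rewrite cells_cons !(in_setU _ (c |: nbr c)) => /orP[xc|xl] /orP[yc|yl].
  + by rewrite !o2E //; apply: o2i.
  + by rewrite o2E // o1E // => e; have := o2U x xc; rewrite e imset_f.
  + by rewrite (o2E y) // o1E // => e; have := o2U y yc; rewrite -e imset_f.
  + by rewrite !o1E //; apply: o1i.
- move=> x; rewrite inE => /orP[/eqP->|xl]; first by rewrite o2E // setU11.
  by rewrite o1E ?o1d //; apply/cellsP; exists x; rewrite ?setU11.
- move=> x; rewrite inE => /orP[/eqP->|xl] q e.
    rewrite !o2E ?setU11 //; last by rewrite in_setU1 in_nbr e orbT.
    by apply: o2s; rewrite in_nbr.
  have qcl : q \in cells cl by apply/cellsP; exists x; rewrite // in_setU1 in_nbr e orbT.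
  have xcl : x \in cells cl by apply/cellsP; exists x; rewrite ?setU11.
  by rewrite !o1E //; apply: o1s.
Qed.

(** [phi] puts the images of the selected slots into the gaps and moves these
    slots to the vertices [vv], reserved or leftover. *)
Lemma fill : contains_subgraph G T.
Proof.
case: (gA) => pA vi dAC dCS gP; case: (pA) => fi fF fe; case: (fW) => WA nW iW.
set S := nbrs C in dCS vi pA fF *; set P := C :|: S.
set F := v @: S in pA fF.
have cO : #|C| <= #|~: occupied A f F|.
  have h1 := cardsC (occupied A f F); rewrite (card_occupiedE pA) (card_in_imset vi) cardGT in h1.
  have h2 := cardsC P; have h3 := (leq_card_setU C S).1.
  have h4 : #|P| = #|C| + #|S|.
    by rewrite cardsU (_ : C :&: S = set0) ?cards0 ?subn0 //; apply/eqP; rewrite setI_eq0.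
  move: h1 h2; rewrite h4 -/P; clear; lia.
case: (set_0Vmem C) => [C0|[c0 c0C]].
  have PE x : x \in A by rewrite /S C0 in_setC in_setU /nbrs big_set0 !inE.
  exists f; split=> [x y|x y]; [exact: fi | exact: fe].
have /card_gt0P[x0 _] : 0 < #|~: occupied A f F|.
  by apply: leq_trans cO; apply/card_gt0P; exists c0.
(* [occupied A f F] leaves exactly one free vertex per centre. *)
pose eta c := nth x0 (enum (~: occupied A f F)) (index c (enum C)).
have idx c : c \in C -> index c (enum C) < size (enum (~: occupied A f F)).
  by move=> cC; rewrite -cardE; apply: leq_trans cO; rewrite cardE index_mem mem_enum.
have eta_in c : c \in C -> eta c \notin occupied A f F.
  by move=> cC; rewrite -in_setC -mem_enum; apply: mem_nth; apply: idx.
have eta_inj : {in C &, injective eta}.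
  move=> c c' cC cC' /eqP; rewrite nth_uniq ?enum_uniq ?idx // => /eqP e.
  by rewrite -[c](@nth_index _ c0 _ (enum C)) ?mem_enum // e nth_index ?mem_enum.
have [|o [oi od os]] := @fill_cells eta (enum C) (enum_uniq _).
  by move=> x; rewrite mem_enum.
have PC x : x \in P -> x \in cells (enum C).
  rewrite in_setU => /orP[xC|/in_nbrs[c cC e]]; apply/cellsP.
    by exists x; rewrite ?mem_enum ?setU11.
  by exists c; rewrite ?mem_enum // in_setU1 in_nbr e orbT.
pose vv x := if x \in C then eta x else v x.
have SC x : x \in S -> (x \in C) = false by move=> xS; rewrite (disjointFl dCS xS).
have vvi : {in P &, injective vv}.
  have vF x : x \in S -> v x \in occupied A f F by move=> xS; rewrite in_setU imset_f ?orbT.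
  move=> x y; rewrite !in_setU /vv => /orP[xC|xS] /orP[yC|yS]; rewrite ?xC ?yC ?(SC x) ?(SC y) //.
  - exact: eta_inj.
  - by move=> e; have := eta_in x xC; rewrite e vF.
  - by move=> e; have := eta_in y yC; rewrite -e vF.
  - exact: vi.
have vvA x a : x \in P -> a \in A -> vv x <> f a.
  rewrite in_setU /vv => /orP[xC|xS] aA; rewrite ?xC ?(SC x) // => e.
    by have := eta_in x xC; rewrite e in_setU imset_f.
  by have := fF a aA; rewrite -e imset_f.
have oD x : x \in P -> o x \in slots f W (vv x).
  rewrite in_setU /vv => /orP[xC|]; first by rewrite xC; apply: od; rewrite mem_enum.
  move=> xS; rewrite SC //; case/in_nbrs: xS => c cC e.
  have cl : c \in enum C by rewrite mem_enum.
  by have [/setIdP[]] := os c cl x e.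
have oW x : x \in P -> o x \in W by move/oD/setIdP=> [].
have oA x : x \in P -> o x \in A by move/oW/(subsetP WA).
have oiP : {in P &, injective o} by move=> x y /PC xP /PC yP; apply: oi.
pose phi x := if x \in P then f (o x)
              else if [pick y in P | o y == x] is Some y then vv y else f x.
have phiP x : [\/ x \in P /\ phi x = f (o x),
    exists y, [/\ y \in P, x = o y & phi x = vv y] |
    [/\ x \in A, forall y, y \in P -> o y != x & phi x = f x]].
  rewrite /phi; case: ifP => xP; first by apply: Or31.
  case: pickP => [y /andP[yP /eqP e]|h]; first by apply: Or32; exists y.
  apply: Or33; split=> //; first by rewrite in_setC xP.
  by move=> y yP; have := h y; rewrite yP /= => ->.
have edgeW x y : x \in W -> edge x y -> y \in A by move/nW/subsetP => h e; apply: h; rewrite inE.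
have AP x : x \in A -> x \notin P by rewrite in_setC.
have edgePA x y : x \in P -> y \in A -> edge x y -> edge (f (o x)) (f y).
  rewrite in_setU => /orP[xC|xS] yA e.
    by exfalso; have := AP y yA; rewrite in_setU negb_or => /andP[_ /negP]; apply; apply/in_nbrs; exists x.
  case/in_nbrs: xS => c cC ecx.
  have cl : c \in enum C by rewrite mem_enum.
  have [/setIdP[_ /subsetP/(_ y)] + _] := os c cl x ecx.
  rewrite !inE e andbT; apply.
  by apply: contraNneq (AP y yA) => ->; rewrite in_setU cC.
(* The only edges inside the gaps join a centre to its neighbours. *)
have edgePP x y : x \in P -> y \in P -> edge x y -> edge (f (o x)) (f (o y)).
  have SS c q : c \in C -> edge c q -> q \in S by move=> cC e; apply/in_nbrs; exists c.
  have CS c q : c \in C -> edge c q -> edge (f (o c)) (f (o q)).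
    by rewrite -mem_enum => cl e; have [] := os c cl q e.
  rewrite !in_setU => /orP[xC|xS] /orP[yC|yS] e.
  - exact: CS.
  - exact: CS.
  - by rewrite edge_sym; apply: CS => //; rewrite edge_sym.
  - exfalso; case/in_nbrs: xS => c cC ecx; have [_ /subsetP/(_ y) + _] := gP c cC x ecx.
    rewrite in_setD1 in_nbr e andbT; have -> : y != c by apply: contraTneq yS => ->; rewrite (disjointFr dCS cC).
    by move/(_ isT)/AP; rewrite in_setU yS orbT.
exists phi; split.
- move=> x y.
  case: (phiP x) => [[xP ->]|[x' [xP ex ->]]|[xA xn ->]];
  case: (phiP y) => [[yP ->]|[y' [yP ey ->]]|[yA yn ->]].
  + by move=> e; apply: oiP => //; apply: fi => //; apply: oA.
  + by move/esym/(vvA _ _ yP (oA _ xP)).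
  + by move/(fi _ _ (oA _ xP) yA) => e; have := yn x xP; rewrite e eqxx.
  + by move/(vvA _ _ xP (oA _ yP)).
  + by move/(vvi _ _ xP yP); rewrite ex ey => ->.
  + by move/(vvA _ _ xP yA).
  + by move/(fi _ _ xA (oA _ yP)) => e; have := xn y yP; rewrite e eqxx.
  + by move/esym/(vvA _ _ yP xA).
  + exact: fi.
- have phiPP x y : x \in P -> edge x y -> edge (phi x) (phi y).
    move=> xP e; have -> : phi x = f (o x) by rewrite /phi xP.
    case: (phiP y) => [[yP ->]|[y' [yP ey _]]|[yA yn ->]].
    + exact: edgePP.
    + exfalso; have yW : y \in W by rewrite ey oW.
      have : x \in A by apply: (edgeW y x yW); rewrite edge_sym.
      by move/AP; rewrite xP.
    + exact: edgePA xP yA e.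
  have phiO x y x' : x' \in P -> x = o x' -> phi x = vv x' -> edge x y -> edge (phi x) (phi y).
    move=> xP ex -> e; have xW : x \in W by rewrite ex oW.
    case: (phiP y) => [[yP _]|[y' [yP ey _]]|[yA yn ->]].
    + by have := AP y (edgeW x y xW e); rewrite yP.
    + by have := iW x xW y e; rewrite ey oW.
    + have /setIdP[_ /subsetP/(_ y)] := oD x' xP; rewrite -ex !inE; exact.
  move=> x y e.
  case: (phiP x) => [[xP _]|[x' [xP ex h1]]|[xA _ hx]]; first exact: phiPP.
    exact: (phiO x y x').
  case: (phiP y) => [[yP _]|[y' [yP ey h1]]|[yA _ hy]].
  + by rewrite edge_sym; apply: phiPP => //; rewrite edge_sym.
  + by rewrite edge_sym; apply: (phiO y x y') => //; rewrite edge_sym.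
  + by rewrite hx hy; apply: fe.
Qed.

End Fill.

(** * Sizes and conclusion *)

Section Assembly.

Variables (D K : nat).

(** Coefficients of the sizes of the construction: [base] is the inverse of the
    fraction kept by one application of [averaging], [anchored_coef * m] the
    number of anchored slots, [slot_coef * m] the number of slots, and
    [occupied_coef * (m + l)] the number of tree vertices treated before the
    leaf-by-leaf extension. *)
Definition base := 128 * K ^ 2.
Definition anchored_coef := 2 * (D + 1) * D.+1 + (D + 2).
Definition slot_coef := base ^ D * anchored_coef + (2 * (D + 1) * D.+1 + D) + 1.
Definition occupied_coef :=
  1 + 2 * base ^ D.+1 * slot_coef * (D + 4) + 2 * (D + 1) * (D + 3) ^ 2.
Definition size_coef :=
  32 * K ^ 2 * (D + 1) + 2 * K * occupied_coef + 2 * occupied_coef * (D + 1) ^ 5.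

Lemma contains_tree (G T : sgraph) m l :
    is_tree T -> #|G| = #|T| -> (forall x : T, #|nbr x| <= D) ->
    (forall x : G, #|G| <= K * #|nbr x|) -> joined G m -> 0 < m ->
    #|G| < 2 ^ l -> size_coef * (m + l) <= #|G| ->
  contains_subgraph G T.
Proof.
move=> tT cardGT degT degG Gm m0 Gl CG.
have [R] := tree_rooting tT.
have n0 : 0 < #|G| by rewrite cardGT; case: tT => [[]].
set n := #|G| in CG degG Gl n0 *.
have K0 : 0 < K.
  have /card_gt0P[x _] := n0; have := degG x; rewrite lt0n => h1.
  by apply: contraTneq n0 => k0; rewrite -leqNgt; rewrite k0 mul0n in h1.
pose s := 2 * m * (D + 1); pose L := s * D.+1 + m * (D + 2).
pose g := base ^ D * L + (s * D.+1 + D * m) + 1.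
pose t := 2 * base ^ D.+1 * (g + l).
pose u := 1 + t * (D + 4) + s * (D + 3) ^ 2.
have eL : L = anchored_coef * m by rewrite /L /s /anchored_coef; clear; nia.
have eg : g <= slot_coef * m.
  have e2 : s * D.+1 + D * m = (2 * (D + 1) * D.+1 + D) * m by rewrite /s; clear; nia.
  by rewrite /g eL e2 mulnA -mulnDl /slot_coef [leqRHS]mulnDl mul1n leq_add2l.
have et : t <= 2 * base ^ D.+1 * slot_coef * (m + l).
  rewrite /t -[leqRHS]mulnA leq_mul2l; apply/orP; right.
  rewrite mulnDr leq_add //; apply: leq_pmull; by rewrite /slot_coef addn1.
have eu : u <= occupied_coef * (m + l).
  rewrite /u /occupied_coef [leqRHS]mulnDl [X in _ <= X + _]mulnDl mul1n.
  apply: leq_add; first apply: leq_add.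
  - by rewrite addn_gt0 m0.
  - by rewrite [leqRHS]mulnAC leq_mul2r et orbT.
  - rewrite /s (mulnAC 2 m) mulnAC leq_mul2l; by rewrite leq_addr orbT.
move: CG; rewrite /size_coef (mulnDl (32 * K ^ 2 * (D + 1) + 2 * K * occupied_coef))
  (mulnDl (32 * K ^ 2 * (D + 1))) => CG.
have C1 : 32 * K ^ 2 * (D + 1) <= n.
  apply: leq_trans CG; rewrite -addnA; apply: leq_trans (leq_addr _ _).
  by rewrite leq_pmulr // addn_gt0 m0.
have C2 : 2 * K * u <= n.
  apply: leq_trans CG; apply: leq_trans (leq_addr _ _); apply: leq_trans (leq_addl _ _).
  by rewrite -(mulnA (2 * K)) leq_mul2l eu orbT.
have C3 : 2 * (u * (D + 1) ^ 5) <= n.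
  apply: leq_trans CG; apply: leq_trans (leq_addl _ _).
  by rewrite mulnA (mulnAC _ _ (m + l)) leq_mul2r -mulnA leq_mul2l eu !orbT.
pose h := n %/ (2 * K).
have K2 : 0 < 2 * K by rewrite muln_gt0.
have uh : u <= h by rewrite /h leq_divRL // mulnC.
have h2 (x : G) : h + u <= #|nbr x|.
  apply: (@leq_trans (h + h)); first by rewrite leq_add2l.
  have h1 : K * (h + h) <= n.
    by rewrite addnn -mul2n mulnCA mulnA mulnC; apply: leq_trunc_div.
  by have := leq_trans h1 (degG x); rewrite leq_pmul2l.
have hn : n <= 4 * K * h.
  have hK : 16 * K * (D + 1) <= h.
    rewrite /h leq_divRL //; apply: leq_trans C1; rewrite -mulnn; clear; nia.
  have := ltn_ceil n K2; rewrite -/h mulSnr => h3.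
  have : 1 <= h by apply: leq_trans hK; rewrite !muln_gt0 K0 addn1.
  by move: h3; clear; nia.
have hK : 16 * K * (D + 1) <= h.
  rewrite /h leq_divRL //; apply: leq_trans C1; rewrite -mulnn; clear; nia.
pose b := h %/ (16 * K).
have K16 : 0 < 16 * K by rewrite muln_gt0.
have bD : D < b by rewrite /b leq_divRL // -addn1 mulnC.
have b0 : 0 < b by apply: leq_ltn_trans bD.
have bh : 16 * K * b <= h by rewrite mulnC; apply: leq_trunc_div.
have hb : h <= 32 * K * b.
  have := ltn_ceil h K16; rewrite -/b mulSnr => h3; move: h3 b0; clear; nia.
have Bb : n <= base * b.
  apply: leq_trans hn _; apply: leq_trans (leq_mul (leqnn (4 * K)) hb) _.
  rewrite /base -mulnn; clear; nia.
have bDh : 2 * (b + D) * n <= h ^ 2.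
  rewrite -mulnn; apply: leq_trans (leq_mul (leqnn _) hn) _.
  rewrite mulnA leq_mul2r; apply/orP; right; apply: leq_trans bh.
  by move: bD; clear; nia.
have bDh' : b + D <= h by move: bh bD K0; clear; nia.
have su : s <= u.
  rewrite /u; apply: leq_trans (leq_addl _ _); rewrite leq_pmulr //.
  by rewrite expn_gt0 addn3.
have mDh : 2 * m * D <= h.
  by apply: leq_trans (leq_trans su uh); rewrite /s leq_mul2l leq_addr orbT.
have mh : 2 * m <= h.
  by apply: leq_trans (leq_trans su uh); rewrite /s leq_pmulr // addn1.
have T_large : u * (D + 1) ^ 5 < #|T|.
  rewrite -cardGT; apply: leq_trans C3; rewrite mul2n -addnn -addn1 leq_add2l.
  by rewrite muln_gt0 expn_gt0 addn1.
have tu : 1 + t * (D + 4) <= u by apply: leq_addr.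
have [A [f [W [dA cA pA fW Wg]]]] :=
  absorbers_exist R Gm degT h2 mh b0 bDh Bb cardGT T_large (g := g) Gl tu.
have [||A1 [f1 [C [v [gA1 sA1 e1 cardC [dA1 cA1]]]]]] :=
   gaps_exist (L := L) (g := g) Gm degT h2 mh b0 bDh' Bb cardGT T_large (s := s) pA fW dA _ _ Wg.
- by rewrite /g -addnA leq_addr.
- by rewrite /u leq_add2r.
have fW1 : flippable A1 W by apply: flippable_sub fW.
have sC : 2 * m * (D + 1) <= #|C| by rewrite cardC.
have [|f2 [gA2 fW2 e2]] := complete Gm m0 degT h2 mDh cardGT sC gA1 fW1 dA1.
  by apply: leq_trans cA1 _; rewrite /u leq_add2r.
apply: (fill Gm m0 degT cardGT gA2 fW2 (g := g)).
- by rewrite cardC.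
- by rewrite cardC /g addn1 ltnS leq_addl.
- move=> x; apply: leq_trans (Wg x) _.
  have e12 : {in A, f2 =1 f} by move=> y yA; rewrite e2 ?e1 // (subsetP sA1).
  by rewrite (eq_slots (A := A) x e12) //; case: fW.
Qed.

End Assembly.

(** It is applied with [l] about [log n]: the number of stars that give slots to
    all the [n] host vertices involves such a term. *)
Lemma exp_beats_linear c :
  exists n0, forall n, n0 <= n -> exists2 l, n < 2 ^ l & c * l <= n.
Proof.
case: (posnP c) => [->|c0].
  exists 0 => n _; exists n; [exact: ltn_expl | by rewrite mul0n].
exists (c * (2 * c + 1)) => n ln; exists (n %/ c); last by rewrite mulnC leq_trunc_div.
have hq : 2 * c + 1 <= n %/ c by rewrite leq_divRL // mulnC.
have key q : 2 * c + 1 <= q -> c * q.+1 <= 2 ^ q.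
  elim: q => [|q IH]; first by rewrite addn1.
  rewrite leq_eqVlt => /orP[/eqP <-|]; last first.
    rewrite ltnS => /IH {}IH.
    by rewrite expnS mul2n -addnn mulnS leq_add // (leq_trans _ IH) // leq_pmulr.
  rewrite expnD expn1 mulnC expnM.
  have : c.+1 <= 2 ^ c by apply: ltn_expl.
  have -> : (2 ^ 2) ^ c = 2 ^ c * 2 ^ c by rewrite -expnM mul2n -addnn expnD.
  clear; nia.
by apply: leq_trans (key _ hq); rewrite mulnC; apply: ltn_ceil.
Qed.

Lemma min_degree_le (G : sgraph) (x : G) : min_degree G <= #|nbr x|.
Proof.
rewrite /min_degree; have : x \in index_enum G by apply: mem_index_enum.
elim: (index_enum G) => //= y s IH; rewrite inE big_cons geq_min.
by case/orP => [/eqP->|/IH ->]; rewrite ?leqnn ?orbT.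
Qed.

(** Equally large parts of [S] and [S'] without an edge between them would be a
    hole larger than the bipartite independence number. *)
Lemma joined_bip_indep (G : sgraph) : joined G (bip_indep_number G).+1.
Proof.
set m := _.+1 => S S' mS mS' dS.
case: (boolP [exists x in S, exists y in S', edge x y]).
  by move=> /exists_inP[x xS /exists_inP[y yS e]]; exists x, y.
move=> /exists_inPn noe; exfalso.
have [S1 sS1 c1] := subset_of_card mS; have [S2 sS2 c2] := subset_of_card mS'.
have mG : m < #|G|.+1 by rewrite ltnS (leq_trans mS) // max_card.
have hole : has_bipartite_hole G m m.
  apply/existsP; exists S1; apply/existsP; exists S2.
  apply/and4P; split; rewrite ?c1 ?c2 //.
    by apply: disjointWl sS1 (disjointWr sS2 dS).
  apply/forall_inP => x xS1; apply/forall_inP => y yS2.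
  have /exists_inPn := noe x (subsetP sS1 x xS1); apply.
  exact: (subsetP sS2).
have := leq_bigmax_cond
  (P := fun t : 'I_(#|G|.+1) => has_bipartite_hole G t t) 
  (F := fun t : 'I_(#|G|.+1) => t : nat) (Ordinal mG) hole.
by rewrite /= -/(bip_indep_number G) ltnn.
Qed.

Local Open Scope ring_scope.

Theorem theorem1p2 (R : realType) (eps : R) (heps : 0 < eps) (Delta : nat) :
  exists alpha : R, 0 < alpha /\
    exists n0 : nat, forall n : nat, (n0 <= n)%N ->
      forall G : sgraph,
        #|G| = n ->
        eps * n%:R <= (min_degree G)%:R ->
        (bip_indep_number G)%:R < alpha * n%:R ->
        universal G (tree_family n Delta).
Proof.
pose K := Num.bound eps^-1.
have epsK : 1 <= K%:R * eps.
  rewrite -ler_pdivrMr // div1r; apply/ltW; apply: archi_boundP.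
  by rewrite invr_ge0 ltW.
set C := size_coef Delta K; have C0 : (0 < C.+1%:R :> R) by rewrite ltr0n.
(* Half of [n] is left for [C * l], the other half for [C * m]. *)
have [n1 hn1] := exp_beats_linear (2 * C).
exists (4 * C.+1%:R)^-1; split; first by rewrite invr_gt0 mulr_gt0 // ltr0n.
exists (n1 + 4 * C.+1)%N => n nn G cG degG bipG T [tT cT maxT].
have [|l nl cl] := hn1 n; first by apply: leq_trans nn; apply: leq_addr.
have bipN : (4 * C.+1 * bip_indep_number G < n)%N.
  rewrite -(ltr_nat R) !natrM -ltr_pdivlMl ?mulr_gt0 ?ltr0n //.
apply: (@contains_tree Delta K G T (bip_indep_number G).+1 l) => //.
- by rewrite cG cT.
- by move=> x; apply: leq_trans maxT; apply: (leq_bigmax x).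
- move=> x; apply: (@leq_trans (K * min_degree G)); last first.
    by rewrite leq_mul2l min_degree_le orbT.
  rewrite cG -(ler_nat R) natrM.
  apply: (@le_trans _ _ (K%:R * (eps * n%:R))); last by rewrite ler_wpM2l.
  by rewrite mulrA ler_peMl.
- exact: joined_bip_indep.
- by rewrite cG.
- rewrite cG -/C; move: nn cl bipN; clear; nia.
Qed.
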